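(* There exists a numerical semigroup ring $R$ with embedding dimension $4$, multiplicity $5$, and type $3$, with maximal ideal $\mathfrak m$ and canonical module $\omega_R$, such that $\mathfrak m\operatorname{Ext}^i_R(\omega_R,R)=0$ for all $i>0$ but $R$ is not nearly Gorenstein.
   Context: A numerical semigroup ring is a ring $k[t^{a_1},\dots,t^{a_s}]$ or its completion $k[\![t^{a_1},\dots,t^{a_s}]\!]$, where $k$ is a field and $a_1<\dots<a_s$ are positive integers with $\gcd$ equal to $1$; $\mathfrak m=(t^{a_1},\dots,t^{a_s})$. Embedding dimension is the minimal number of generators of $\mathfrak m$; the multiplicity is the Hilbert-Samuel multiplicity $e(R)$ with respect to $\mathfrak m$ (which equals $a_1$); the type is $\dim_k\operatorname{Ext}^1_R(k,R)$ (here $\operatorname{depth}R=1$). The trace ideal of a module $M$ is $\operatorname{tr}_R(M)=\langle f(u)\mid u\in M,\ f\in\operatorname{Hom}_R(M,R)\rangle$. $R$ is nearly Gorenstein if $\operatorname{tr}_R(\omega_R)\supseteq\mathfrak m$. *)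

(* Defs.v *)
From HB Require Import structures.
From mathcomp Require Import all_boot all_order all_algebra.
From mathcomp Require Import boolp classical_sets.

Set Implicit Arguments.
Unset Strict Implicit.
Unset Printing Implicit Defensive.

Import GRing.Theory.
Local Open Scope classical_set_scope.
Local Open Scope ring_scope.

(** * Formal power series in one variable *)

(* A series is the sequence of its coefficients, with the Cauchy product. *)
Record fps (k : Type) := Fps { fps_coef : nat -> k }.

HB.instance Definition _ (k : Type) := gen_eqMixin (fps k).
HB.instance Definition _ (k : Type) := gen_choiceMixin (fps k).

Section FpsAlgebra.
Variable k : comNzRingType.
Implicit Types f g h : fps k.

Lemma fpsP f g : (forall n, fps_coef f n = fps_coef g n) -> f = g.
Proof. by case: f g => f [g] /= fg; congr Fps; apply/funext. Qed.

Definition fps_zero : fps k := Fps (fun=> 0).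
Definition fps_opp f := Fps (fun n => - fps_coef f n).
Definition fps_add f g := Fps (fun n => fps_coef f n + fps_coef g n).
Definition fps_one : fps k := Fps (fun n => (n == 0)%:R).
Definition fps_mul f g :=
  Fps (fun n => \sum_(i < n.+1) fps_coef f i * fps_coef g (n - i)).
Definition fps_scale (c : k) f := Fps (fun n => c * fps_coef f n).

Fact fps_addA : associative fps_add.
Proof. by move=> f g h; apply: fpsP => n /=; rewrite addrA. Qed.
Fact fps_addC : commutative fps_add.
Proof. by move=> f g; apply: fpsP => n /=; rewrite addrC. Qed.
Fact fps_add0 : left_id fps_zero fps_add.
Proof. by move=> f; apply: fpsP => n /=; rewrite add0r. Qed.
Fact fps_addN : left_inverse fps_zero fps_opp fps_add.
Proof. by move=> f; apply: fpsP => n /=; rewrite addNr. Qed.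

HB.instance Definition _ :=
  GRing.isZmodule.Build (fps k) fps_addA fps_addC fps_add0 fps_addN.

(* The polynomial that agrees with f in degrees < N. *)
Let tr N f : {poly k} := \poly_(i < N) fps_coef f i.

Let tr_mul N f g n : (n < N)%N ->
  fps_coef (fps_mul f g) n = (tr N f * tr N g)`_n.
Proof.
move=> nN; rewrite coefM; apply: eq_bigr => i _ /=.
have iN : (i < N)%N := leq_ltn_trans (ltn_ord i : (i <= n)%N) nN.
by rewrite !coef_poly iN (leq_ltn_trans (leq_subr i n) nN).
Qed.

Fact fps_mulA : associative fps_mul.
Proof.
move=> f g h; apply: fpsP => n.
have tr_coef u m : (m < n.+1)%N -> fps_coef u m = (tr n.+1 u)`_m.
  by move=> mn; rewrite coef_poly mn.
rewrite !(@tr_mul n.+1) //.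
transitivity ((tr n.+1 f * (tr n.+1 g * tr n.+1 h))`_n).
  rewrite !coefM; apply: eq_bigr => i _; congr (_ * _).
  by rewrite -tr_coef ?ltnS ?leq_subr // (@tr_mul n.+1) // ltnS leq_subr.
rewrite mulrA !coefM; apply: eq_bigr => i _; congr (_ * _).
by rewrite -tr_coef // (@tr_mul n.+1).
Qed.
Fact fps_mulC : commutative fps_mul.
Proof. by move=> f g; apply: fpsP => n; rewrite !(@tr_mul n.+1) // mulrC. Qed.
Fact fps_mul1 : left_id fps_one fps_mul.
Proof.
move=> f; apply: fpsP => n /=.
by rewrite big_ord_recl /= mul1r subn0 big1 ?addr0 // => i _; rewrite mul0r.
Qed.
Fact fps_mulDl : left_distributive fps_mul fps_add.
Proof.
move=> f g h; apply: fpsP => n /=; rewrite -big_split /=.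
by apply: eq_bigr => i _; rewrite mulrDl.
Qed.
Fact fps_one_neq0 : fps_one != fps_zero.
Proof.
by apply/eqP => /(congr1 (fun f => fps_coef f 0)) /eqP; rewrite oner_eq0.
Qed.

HB.instance Definition _ := GRing.Zmodule_isComNzRing.Build (fps k)
  fps_mulA fps_mulC fps_mul1 fps_mulDl fps_one_neq0.

Fact fps_scaleA a b f : fps_scale a (fps_scale b f) = fps_scale (a * b) f.
Proof. by apply: fpsP => n /=; rewrite mulrA. Qed.
Fact fps_scale1 : left_id 1 fps_scale.
Proof. by move=> f; apply: fpsP => n /=; rewrite mul1r. Qed.
Fact fps_scaleDr : right_distributive fps_scale +%R.
Proof. by move=> a f g; apply: fpsP => n /=; rewrite mulrDr. Qed.
Fact fps_scaleDl f : {morph fps_scale^~ f : a b / a + b}.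
Proof. by move=> a b; apply: fpsP => n /=; rewrite mulrDl. Qed.

HB.instance Definition _ := GRing.Zmodule_isLmodule.Build k (fps k)
  fps_scaleA fps_scale1 fps_scaleDr fps_scaleDl.

Fact fps_scaleAl (a : k) f g : a *: (f * g) = (a *: f) * g.
Proof.
apply: fpsP => n /=; rewrite mulr_sumr.
by apply: eq_bigr => i _; rewrite mulrA.
Qed.

HB.instance Definition _ := GRing.Lmodule_isLalgebra.Build k (fps k) fps_scaleAl.
HB.instance Definition _ := GRing.Lalgebra_isComAlgebra.Build k (fps k).

Definition fps_Xn (n : nat) : fps k := Fps (fun i => (i == n)%:R).

End FpsAlgebra.

(** * Ideals *)

Section Ideals.
Variable R : comNzRingType.
Implicit Types I J n : set R.

Definition is_ideal I : Prop :=
  [/\ I 0, forall x y, I x -> I y -> I (x + y) & forall r x, I x -> I (r * x)].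

Definition maximal_ideal n : Prop :=
  [/\ is_ideal n, n <> setT &
      forall J, is_ideal J -> n `<=` J -> J = n \/ J = setT].

Definition ideal_span (X : set R) : set R :=
  [set y | exists (l : nat) (r x : 'I_l -> R),
     (forall i, X (x i)) /\ y = \sum_i r i * x i].

Definition ideal_mul I J : set R :=
  ideal_span [set z | exists x y, [/\ I x, J y & z = x * y]].

Definition ideal_exp I (l : nat) : set R := iter l (ideal_mul I) setT.

Definition generated_by I (l : nat) : Prop :=
  exists x : 'I_l -> R, I = ideal_span (range x).

Definition min_generators I (l : nat) : Prop :=
  generated_by I l /\ forall l', generated_by I l' -> (l <= l')%N.

(* The R-module R/I has length l: there is a composition series
   R = J 0 > J 1 > ... > J l = I. *)
Definition colength I (l : nat) : Prop :=
  exists J : nat -> set R,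
    [/\ J 0 = setT, J l = I, forall i, (i <= l)%N -> is_ideal (J i) &
        forall i, (i < l)%N ->
          [/\ J i.+1 `<=` J i, J i.+1 <> J i &
              forall L, is_ideal L -> J i.+1 `<=` L -> L `<=` J i ->
                L = J i.+1 \/ L = J i]].

(* The Hilbert-Samuel polynomial, with value length (R / I^(l+1)) at l >> 0,
   has degree d = dim R and leading coefficient e / d`!. *)
Definition hilbert_samuel_multiplicity I (e : nat) : Prop :=
  exists P : {poly rat},
    (exists N : nat, forall l, (N <= l)%N ->
       exists2 c, colength (ideal_exp I l.+1) c & P.[l%:R] = c%:R) /\
    lead_coef P * ((size P).-1`!)%:R = e%:R.

End Ideals.

(** * Modules, Ext and canonical modules *)

Section Modules.
Variable R : comNzRingType.
Implicit Types M N E C W K : lmodType R.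
Implicit Types I n : set R.

Definition projective_module M : Prop :=
  forall (A B : lmodType R) (p : {linear A -> B}) (f : {linear M -> B}),
    range p = setT -> exists g : {linear M -> A}, forall x, p (g x) = f x.

Definition injective_module E : Prop :=
  forall (A B : lmodType R) (j : {linear A -> B}) (f : {linear A -> E}),
    injective j -> exists g : {linear B -> E}, forall x, g (j x) = f x.

Definition finitely_generated M : Prop :=
  exists (l : nat) (x : 'I_l -> M),
    forall y, exists r : 'I_l -> R, y = \sum_i r i *: x i.

Record projective_resolution M := ProjectiveResolution {
  pr_mod : nat -> lmodType R;
  pr_diff : forall i, {linear pr_mod i.+1 -> pr_mod i};
  pr_aug : {linear pr_mod 0 -> M};
  pr_proj : forall i, projective_module (pr_mod i);
  pr_aug_surj : range pr_aug = setT;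
  pr_exact0 : [set x | pr_aug x = 0] = range (pr_diff 0);
  pr_exact : forall i, [set x | pr_diff i x = 0] = range (pr_diff i.+1)
}.

(* Ext^i_R(M, N) is the group of i-cocycles modulo i-coboundaries of the complex
   Hom_R(P, N), for P a projective resolution of M. *)
Section Ext.
Variables (M N : lmodType R) (P : projective_resolution M).

Definition cocycle (i : nat) (z : pr_mod P i -> N) : Prop :=
  forall y, z (pr_diff P i y) = 0.

Definition coboundary (i : nat) : (pr_mod P i -> N) -> Prop :=
  match i return (pr_mod P i -> N) -> Prop with
  | 0 => fun z => forall y, z y = 0
  | j.+1 => fun z =>
      exists w : {linear pr_mod P j -> N}, forall y, z y = w (pr_diff P j y)
  end.

End Ext.

(* Properties of Ext^i_R(M, N) do not depend on the resolution; requiring one to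
   exist, rather than quantifying over all of them, cannot hold vacuously. *)
Definition annihilates_Ext I (i : nat) M N : Prop :=
  exists P : projective_resolution M,
    forall (r : R) (z : {linear pr_mod P i -> N}),
      I r -> cocycle z -> coboundary (fun y => r *: z y).

Definition quotient_module I K : Prop :=
  exists p : {linear R^o -> K}, range p = setT /\ [set r | p r = 0] = I.

(* For a maximal ideal n: dim_(R/n) Ext^i_R(R/n, N) = l, i.e. the i-th Bass number
   of N at n.  The classes of b form a basis over R/n. *)
Definition bass_number n (i : nat) N (l : nat) : Prop :=
  exists (K : lmodType R) (P : projective_resolution K)
         (b : 'I_l -> {linear pr_mod P i -> N}),
    [/\ quotient_module n K,
        forall j, cocycle (b j),
        forall z : {linear pr_mod P i -> N}, cocycle z ->
          exists r : 'I_l -> R, coboundary (fun y => z y - \sum_j r j *: b j y) &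
        forall r : 'I_l -> R,
          coboundary (fun y => \sum_j r j *: b j y) <-> forall j, n (r j)].

Definition finite_injective_dimension C : Prop :=
  exists (E : nat -> lmodType R) (d : forall i, {linear E i -> E i.+1})
         (e : {linear C -> E 0}),
    [/\ forall i, injective_module (E i),
        injective e,
        range e = [set x | d 0 x = 0],
        forall i, range (d i) = [set x | d i.+1 x = 0] &
        exists l, forall i, (l <= i)%N -> forall x : E i, x = 0].

(* R is Noetherian, Cohen-Macaulay, with all maximal ideals of height 1.  A canonical
   module is a finitely generated module of finite injective dimension that is
   maximal Cohen-Macaulay (depth 1, so Ext^0_R(R/n, C) = 0) and of type 1 at each
   maximal ideal n.  As Ext^i_R(R/n, C) is its own localization at n, no localization
   is needed when R is not local.  For R local, n is the maximal ideal of R. *)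
Definition canonical_module C : Prop :=
  [/\ finitely_generated C, finite_injective_dimension C &
      forall n, maximal_ideal n -> bass_number n 0 C 0 /\ bass_number n 1 C 1].

Definition trace_ideal M : set R :=
  ideal_span [set r | exists (f : {linear M -> R^o}) (u : M), r = f u].

Definition nearly_gorenstein I W : Prop := I `<=` trace_ideal W.

End Modules.

(** * Numerical semigroup rings *)

Definition in_semigroup (a : seq nat) (n : nat) : Prop :=
  exists c : nat -> nat, n = (\sum_(i < size a) c i * nth 0 a i)%N.

Definition numerical_generators (a : seq nat) : Prop :=
  [/\ sorted ltn a, all (ltn 0) a & \big[gcdn/0%N]_(x <- a) x = 1%N].

Section SemigroupRing.
Variables (k : fieldType) (a : seq nat) (R : comAlgType k) (m : set R).

(* R = k[t^a1, ..., t^as], up to an isomorphism of k-algebras, with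
   m = (t^a1, ..., t^as). *)
Definition semigroup_poly_ring : Prop :=
  exists phi : {lrmorphism R -> {poly k}},
    [/\ injective phi,
        range phi = [set p | forall n, p`_n != 0 -> in_semigroup a n] &
        m = ideal_span [set x | exists2 n, n \in a & phi x = 'X^n]].

(* R = k[[t^a1, ..., t^as]], with m = (t^a1, ..., t^as). *)
Definition semigroup_series_ring : Prop :=
  exists phi : {lrmorphism R -> fps k},
    [/\ injective phi,
        range phi = [set f | forall n, fps_coef f n != 0 -> in_semigroup a n] &
        m = ideal_span [set x | exists2 n, n \in a & phi x = fps_Xn k n]].

Definition numerical_semigroup_ring : Prop :=
  numerical_generators a /\ (semigroup_poly_ring \/ semigroup_series_ring).

End SemigroupRing.

(* Main.v *)
Require Import Defs.
From HB Require Import structures.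
From mathcomp Require Import all_boot all_order all_algebra.
From mathcomp Require Import fraction generic_quotient.
From mathcomp Require Import boolp classical_sets.
From mathcomp Require Import zify ring.

(* Take the semigroup H = {0, 5, 6} u [10, oo) generated by 5, 6, 13, 14, so
   R = k[[H]], and the canonical module omega with value set
   W = {n | 9 - n notin H} = {0, 1, 2, 5, 6, 7, 8} u [10, oo).  With
   N1 = {0} u [5, oo) and N2 = {0, 1} u [5, oo) (so that m = t^5 N2), the relations
   between the monomial generators live on the edges of a tree, and the first
   syzygies are again monomial:
     Omega(W) = N1^2, Omega(N1) = N2^3, Omega(N2) = N1 + N2^2, Omega(k) = N2.
   Hence every Ext^i(omega, R), i > 0, is controlled by these finitely many covers,
   and on each of them r f extends to the free module for all f : syzygy -> R and
   r in m.  On the other hand q omega is contained in R only for q in t^10 k[[t]],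
   so the trace of omega misses t^5.  Finite injective dimension of omega comes from
   0 -> omega -> k((t)) -> Hom_cont(R, k) -> 0, where q goes to x |-> coefficient of
   t^9 in x q; both modules on the right are injective by Baer's criterion. *)

Set Implicit Arguments.
Unset Strict Implicit.
Unset Printing Implicit Defensive.

Import GRing.Theory.
Local Open Scope classical_set_scope.
Local Open Scope ring_scope.

(** * Linear maps and projective modules *)

Section LinearMaps.
Variable R : comNzRingType.
Implicit Types U V W M N : lmodType R.

(** Extension of r f rests on m = t^5 N2. For f : N2 -> R and r = t^5 v one has r f(u) = t^5 v f(u)
    = t^5 u f(v) with f(v) in R, and in the covers of N1 and N2 the relation at a leaf has the entry
    -t^5 there. So a summand N2 extends by its own coordinate. The obstacle is a summand N1: there f
    is multiplication by some q in m, and r q in m^2 may have a term in degree 12, which is outside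
    5 + H and has to be absorbed through the other entry, t^6, of the relation.

    The generators 1, t, t^2 of omega have degrees 9 - 9, 9 - 8, 9 - 7, where 7, 8, 9 are the
    pseudo-Frobenius numbers of H; there are three of them, whence type 3. Working with series
    rather than polynomials makes R local, so omega is tested at one maximal ideal only. *)

Definition linmap U V (f : U -> V) (f_lin : linear f) : {linear U -> V} :=
  HB.pack f (GRing.isLinear.Build R U V _ f f_lin).

Lemma exists_linear U V (f : U -> V) :
  linear f -> exists g : {linear U -> V}, forall x, g x = f x.
Proof. by move=> f_lin; exists (linmap f_lin). Qed.

(** A section of [p] need not be linear, but its failure to be so lies in the kernel of [p], which
    [f] kills. *)
Lemma factor_through_surjection U V M (p : {linear U -> V}) (f : {linear U -> M}) :
  range p = setT -> (forall x, p x = 0 -> f x = 0) ->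
  exists g : {linear V -> M}, forall x, g (p x) = f x.
Proof.
move=> p_surj ker.
have /choice [s sK] : forall v, exists u, p u = v.
  move=> v; have [u _ <-] : range p v by rewrite p_surj.
  by exists u.
have fs u : f (s (p u)) = f u.
  by apply/eqP; rewrite -subr_eq0 -linearB ker // linearB sK subrr.
have [|g gE] := @exists_linear _ _ (f \o s).
  move=> a u v /=; rewrite -linearP -[LHS]fs sK.
  by rewrite -[RHS]fs linearP !sK.
by exists g => u; rewrite gE /= fs.
Qed.

Lemma projective_regular : projective_module (R^o : lmodType R).
Proof.
move=> A B p f p_surj.
have [a _ pa] : range p (f (1 : R)) by rewrite p_surj.
have [|g gE] := @exists_linear R^o A (fun r => r *: a).
  by move=> r x y; rewrite scalerDl -scalerA.
exists g => x; rewrite gE linearZ /= pa -linearZ /=.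
by congr (f _); exact: mulr1.
Qed.

Lemma linear_pair_split U V W (f : {linear (U * V)%type -> W}) :
  exists (f1 : {linear U -> W}) (f2 : {linear V -> W}),
    forall x, f x = f1 x.1 + f2 x.2.
Proof.
have [|f1 f1E] := @exists_linear U W (fun u => f (u, 0)).
  by move=> a u v; rewrite -linearP; congr (f _); congr pair; rewrite /= scaler0 addr0.
have [|f2 f2E] := @exists_linear V W (fun v => f (0, v)).
  by move=> a u v; rewrite -linearP; congr (f _); congr pair; rewrite /= scaler0 addr0.
exists f1, f2 => -[u v]; rewrite f1E f2E -linearD.
by congr (f _); congr pair; rewrite /= ?addr0 ?add0r.
Qed.

Lemma linear_pair_glue U V W (f1 : {linear U -> W}) (f2 : {linear V -> W}) :
  exists f : {linear (U * V)%type -> W}, forall x, f x = f1 x.1 + f2 x.2.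
Proof.
by apply: exists_linear => a u v /=; rewrite !linearP scalerDr addrACA.
Qed.

Lemma projective_pair U V :
  projective_module U -> projective_module V ->
  projective_module (U * V)%type.
Proof.
move=> projU projV A B p f p_surj.
have [f1 [f2 fE]] := linear_pair_split f.
have [g1 g1E] := projU A B p f1 p_surj.
have [g2 g2E] := projV A B p f2 p_surj.
have [g gE] := linear_pair_glue g1 g2.
by exists g => x; rewrite gE linearD /= g1E g2E fE.
Qed.

End LinearMaps.

(** * Ideals spanned by a set *)

Section IdealSpan.
Variable R : comNzRingType.
Implicit Types (X I J : set R).

Lemma ideal_span_ideal X : is_ideal (ideal_span X).
Proof.
split.
- by exists 0%N, (fun=> 0), (fun=> 0); split; [case | rewrite big_ord0].
- move=> x y [l [r [u [Xu ->]]]] [l' [r' [u' [Xu' ->]]]].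
  exists (l + l')%N, (fun i => match split i with inl j => r j | inr j => r' j end),
    (fun i => match split i with inl j => u j | inr j => u' j end).
  split; first by move=> i; case: (split i).
  rewrite big_split_ord /=; congr (_ + _); apply: eq_bigr => i _.
    by rewrite (unsplitK (inl i) : split (lshift _ _) = _).
  by rewrite (unsplitK (inr i) : split (rshift _ _) = _).
- move=> a x [l [r [u [Xu ->]]]]; exists l, (fun i => a * r i), u; split=> //.
  by rewrite mulr_sumr; apply: eq_bigr => i _; rewrite mulrA.
Qed.

Lemma ideal_span_gen X x : X x -> ideal_span X x.
Proof.
by exists 1%N, (fun=> 1), (fun=> x); split=> //; rewrite big_ord1 mul1r.
Qed.

Lemma ideal_span_sub X I : is_ideal I -> X `<=` I -> ideal_span X `<=` I.
Proof.
move=> [I0 ID IM] XI x [l [r [u [Xu ->]]]].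
by elim/big_ind: _ => // i _; apply/IM/XI.
Qed.

End IdealSpan.

(** * Baer's criterion *)

Section Baer.
Variables (R : comNzRingType) (E : lmodType R).

(** Only the values of [f] on [I] matter; a total function avoids turning [I] into a module. *)
Definition extends_from_ideals := forall (I : set R) (f : R -> E),
  is_ideal I -> (forall x y, I x -> I y -> f (x + y) = f x + f y) ->
  (forall r x, I x -> f (r * x) = r *: f x) ->
  exists e, forall x, I x -> f x = x *: e.

Hypothesis extE : extends_from_ideals.

Section Extension.
Variables (A B : lmodType R) (j : {linear A -> B}) (f : {linear A -> E}).
Hypothesis j_inj : injective j.

(* The graphs of the linear maps from submodules of B to E. *)
Let graph (G : set (B * E)) :=
  [/\ forall x y, G x -> G y -> G (x + y), forall r x, G x -> G (r *: x) &
      forall e, G (0, e) -> e = 0].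
Let graph_f : set (B * E) := range (fun a => (j a, f a)).

Let graph_fP : graph graph_f.
Proof.
split.
- by move=> _ _ [a _ <-] [b _ <-]; exists (a + b) => //; rewrite !linearD.
- by move=> r _ [a _ <-]; exists (r *: a) => //; rewrite !linearZ.
- move=> _ [a _ [ja0 <-]]; rewrite (_ : a = 0) ?linear0 //.
  by apply: j_inj; rewrite ja0 linear0.
Qed.

Let maximal_graph : exists G, [/\ graph G, graph_f `<=` G &
  forall G', graph G' -> G `<=` G' -> G' `<=` G].
Proof.
(* The empty set is allowed because Zorn_bigcup also asks for the empty chain. *)
pose P G := graph G /\ (G = set0 \/ graph_f `<=` G).
have [F FP Ftot|G [[gG G0f] Gmax]] := @Zorn_bigcup _ P.
  have step x y : (\bigcup_(X in F) X) x -> (\bigcup_(X in F) X) y ->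
      exists2 X, F X & X x /\ X y.
    move=> [X FX Xx] [Y FY Yy]; have [XY|YX] := Ftot _ _ FX FY.
    - by exists Y => //; split=> //; apply: XY.
    - by exists X => //; split=> //; apply: YX.
  split.
    split.
    - move=> x y xF yF; have [X FX [Xx Xy]] := step _ _ xF yF.
      by exists X => //; have [[+ _ _] _] := FP _ FX; apply.
    - move=> r x [X FX Xx]; exists X => //.
      by have [[_ + _] _] := FP _ FX; apply.
    - move=> e [X FX Xe]; have [[_ _ +] _] := FP _ FX; exact.
  have [[X [FX [x Xx]]]|F0] := pselect (exists X, F X /\ exists x, X x).
    right; have [_ [X0|fX]] := FP _ FX; first by rewrite X0 in Xx.
    by move=> y /fX Xy; exists X.
  left; rewrite -subset0 => x [X FX Xx]; apply: F0.
  by exists X; split=> //; exists x.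
have fG : graph_f `<=` G.
  case: G0f => // G0; case: (Gmax graph_f); last by split; [exact: graph_fP|right].
  rewrite G0 properEneq; split=> //; apply/eqP => f0.
  by have : set0 ((j 0, f 0) : B * E) by rewrite f0; exists 0.
exists G; split=> // G' gG' GG'; apply: contrapT => G'G.
apply: (Gmax G'); first by [].
by split=> //; right; apply: subset_trans GG'.
Qed.

Lemma baer_extension : exists g : {linear B -> E}, forall x, g (j x) = f x.
Proof.
have [G [[GD GZ G0] fG Gmax]] := maximal_graph.
have G00 : G (0, 0).
  by apply: fG; exists 0 => //; rewrite !linear0.
have Gfun b e e' : G (b, e) -> G (b, e') -> e = e'.
  move=> Ge /(GZ (-1)) /(GD _ _ Ge) Ge'; apply/eqP; rewrite -subr_eq0; apply/eqP.
  apply: G0; move: Ge'; rewrite !scaleN1r.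
  by congr (G _); congr pair; rewrite /= ?subrr // scaleN1r.
(* Baer's hypothesis is applied to the ideal of all r with r b in the domain of [G]. It yields a
   value [e0] for [b], and [G] enlarged by (b, e0) is still a graph, hence contained in [G] by
   maximality. *)
have total b : exists e, G (b, e).
  pose I : set R := [set r | exists e, G (r *: b, e)].
  have /choice [phi phiP] : forall r, exists e, I r -> G (r *: b, e).
    move=> r; have [[e Ge]|nI] := pselect (I r); first by exists e.
    by exists 0.
  have [|x y Ix Iy|r x Ix|e0 e0P] := extE (I := I) (f := phi).
  - split.
    + by exists 0; rewrite scale0r.
    + move=> x y [e Ge] [e' Ge']; exists (e + e').
      by rewrite scalerDl; exact: GD Ge Ge'.
    + by move=> r x [e Ge]; exists (r *: e); rewrite -scalerA; exact: GZ Ge.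
  - have Gxy := GD _ _ (phiP _ Ix) (phiP _ Iy).
    apply: Gfun (Gxy); rewrite -scalerDl; apply: phiP.
    by exists (phi x + phi y); rewrite scalerDl.
  - have Gx := GZ r _ (phiP _ Ix).
    apply: Gfun (Gx); rewrite scalerA; apply: phiP.
    by exists (r *: phi x); rewrite -scalerA.
  pose G' : set (B * E) :=
    [set z | exists x r, G x /\ z = (x.1 + r *: b, x.2 + r *: e0)].
  exists e0; apply: (Gmax G'); last first.
  - by exists (0, 0), 1; split=> //=; rewrite !add0r !scale1r.
  - move=> x Gx; exists x, 0; split=> //; rewrite !scale0r !addr0.
    by case: (x).
  split.
  - move=> _ _ [x [r [Gx ->]]] [y [s [Gy ->]]]; exists (x + y), (r + s).
    split; first exact: GD.
    by congr pair; rewrite /= scalerDl addrACA.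
  - move=> s _ [x [r [Gx ->]]]; exists (s *: x), (s * r); split; first exact: GZ.
    by congr pair; rewrite /= scalerDr scalerA.
  - move=> _ [[x y] [r [Gx [/= xr ->]]]].
    have rb : r *: b = - x by apply/eqP; rewrite -addr_eq0 addrC -xr.
    have Grb : G (r *: b, - y).
      by rewrite rb -!scaleN1r; exact: (GZ (-1) _ Gx).
    have Ir : I r by exists (- y).
    by rewrite -e0P // (Gfun _ _ _ (phiP _ Ir) Grb) subrr.
have /choice [g gP] := total.
have [|h hE] := @exists_linear _ _ _ g.
  move=> a u v; apply: Gfun (gP _) _.
  exact: GD (GZ a _ (gP u)) (gP v).
exists h => x; rewrite hE; apply: Gfun (gP _) _.
by apply: fG; exists x.
Qed.

End Extension.

Lemma baer_criterion : injective_module E.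
Proof. by move=> A B j f; exact: baer_extension. Qed.

End Baer.

(** * Projective resolutions from short exact sequences *)

Section Covers.
Variable R : comNzRingType.
Implicit Types M N : lmodType R.

(** A sequence 0 -> Omega -> P -> M -> 0; Omega is a module in its own right, so that it can be a
    prescribed monomial module rather than a kernel. *)
Record proj_cover M := Cover {
  cover_mod : lmodType R;
  cover_syz : lmodType R;
  cover_inj : {linear cover_syz -> cover_mod};
  cover_map : {linear cover_mod -> M};
  cover_proj : projective_module cover_mod;
  cover_injP : injective cover_inj;
  cover_surj : range cover_map = setT;
  cover_exact : [set x | cover_map x = 0] = range cover_inj
}.

Section Resolution.
Variables (C : lmodType R -> Prop) (D : forall M, proj_cover M -> Prop).
Hypothesis coverC : forall M, C M -> exists c : proj_cover M, C (cover_syz c) /\ D c.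
Variables (M : lmodType R) (c0 : proj_cover M) (C0 : C (cover_syz c0)) (D0 : D c0).

(** The state carries its cover, so that the syzygy of one stage is the module covered at the next,
    and [D] is remembered for every cover used. [M] enters through [c0], without being asked to lie
    in [C]. *)
Let state := {N : lmodType R & {c : proj_cover N | C (cover_syz c) /\ D c}}.
Let cov (s : state) : proj_cover (projT1 s) := sval (projT2 s).
Let covC (s : state) : C (cover_syz (cov s)) := (proj2_sig (projT2 s)).1.
Let covD (s : state) : D (cov s) := (proj2_sig (projT2 s)).2.
Let next (s : state) : state :=
  existT _ (cover_syz (cov s)) (cid (coverC (covC s))).
Let st i : state := iter i next (existT _ M (exist _ c0 (conj C0 D0))).

Let dif (s : state) : {linear cover_mod (cov (next s)) -> cover_mod (cov s)} :=
  cover_inj (cov s) \o cover_map (cov (next s)).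

Let dif_exact0 (s : state) : [set x | cover_map (cov s) x = 0] = range (dif s).
Proof.
rewrite cover_exact; apply/seteqP; split=> x [y _ <-].
  have [z _ <-] : range (cover_map (cov (next s))) y by rewrite cover_surj.
  by exists z.
by exists (cover_map (cov (next s)) y).
Qed.

Let dif_exact (s : state) : [set x | dif s x = 0] = range (dif (next s)).
Proof.
rewrite -dif_exact0; apply/seteqP; split=> x /= => [h|->]; last by rewrite linear0.
by apply: (@cover_injP _ (cov s)); rewrite h linear0.
Qed.

Let P : projective_resolution M :=
  @ProjectiveResolution R M (fun i => cover_mod (cov (st i))) (fun i => dif (st i))
    (cover_map c0) (fun i => @cover_proj _ (cov (st i))) (cover_surj c0)
    (dif_exact0 (st 0)) (fun i => dif_exact (st i)).

Let cocycle_factor (N : lmodType R) i (z : {linear pr_mod P i.+1 -> N}) : cocycle z ->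
  exists f : {linear cover_syz (cov (st i)) -> N},
    forall y, f (cover_map (cov (st i.+1)) y) = z y.
Proof.
move=> zP; apply: factor_through_surjection; first exact: cover_surj.
move=> x x0; have [y _ <-] : range (dif (st i.+1)) x by rewrite -dif_exact0.
exact: zP.
Qed.

(** A cocycle in degree i + 1 is a map on the syzygy of stage i, and it is a coboundary when that
    map extends to the projective module of the same stage. *)
Lemma annihilates_Ext_of_covers (I : set R) (N : lmodType R) i :
  (forall (L : lmodType R) (c : proj_cover L), D c ->
     forall (r : R) (f : {linear cover_syz c -> N}), I r ->
     exists g : {linear cover_mod c -> N}, forall x, g (cover_inj c x) = r *: f x) ->
  annihilates_Ext I i.+1 M N.
Proof.
move=> ext; exists P => r z Ir /cocycle_factor [f fE].
have [g gE] := ext _ _ (covD (st i)) r f Ir.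
by exists g => y /=; rewrite gE; congr (_ *: _); rewrite -[LHS]fE.
Qed.

(** Ext^1 is the cokernel of Hom(P, N) -> Hom(Omega, N), so the first cover alone computes it. *)
Lemma bass_number1_of_cover (n : set R) (N : lmodType R) l
    (b : 'I_l -> {linear cover_syz c0 -> N}) :
  quotient_module n M ->
  (forall f : {linear cover_syz c0 -> N},
     exists (r : 'I_l -> R) (g : {linear cover_mod c0 -> N}),
       forall x, f x - \sum_j r j *: b j x = g (cover_inj c0 x)) ->
  (forall r : 'I_l -> R, (exists g : {linear cover_mod c0 -> N},
       forall x, \sum_j r j *: b j x = g (cover_inj c0 x)) <-> forall j, n (r j)) ->
  bass_number n 1 N l.
Proof.
move=> nM b_span b_free.
exists M, P, (fun j => b j \o cover_map (cov (st 1))); split=> //.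
- move=> j y /=; rewrite (_ : cover_map _ _ = 0) ?linear0 //.
  have : range (dif (st 1)) (dif (st 1) y) by exists y.
  by rewrite -dif_exact0.
- move=> z /cocycle_factor [f fE]; have [r [g gE]] := b_span f.
  by exists r, g => y /=; rewrite -gE -[z y]fE.
- move=> r; rewrite -b_free; split=> -[g gE]; exists g => x; last exact: gE.
  have [y _ <-] : range (cover_map (cov (st 1))) x by rewrite cover_surj.
  exact: gE.
Qed.

Lemma bass_number0_of_cover (n : set R) (N : lmodType R) :
  quotient_module n M -> (forall (f : {linear M -> N}) x, f x = 0) ->
  bass_number n 0 N 0.
Proof.
move=> nM f0; have b : 'I_0 -> {linear pr_mod P 0 -> N} by case.
exists M, P, b; split=> //; first by case.
- move=> z zP; exists (fun=> 0) => y; rewrite big_ord0 subr0.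
  have [|x x0|f <-] := @factor_through_surjection R _ M N (cover_map c0) z.
  + exact: cover_surj.
  + have [y' _ <-] : range (dif (st 0)) x by rewrite -dif_exact0.
    exact: zP.
  + exact: f0.
- by move=> r; split=> [_ []|_ y] //; rewrite big_ord0.
Qed.

End Resolution.

Section PairCover.
Variables (M1 M2 : lmodType R) (c1 : proj_cover M1) (c2 : proj_cover M2).

Let map2 (U1 U2 V1 V2 : lmodType R) (f : {linear U1 -> V1}) (g : {linear U2 -> V2}) :
  linear (fun x : U1 * U2 => (f x.1, g x.2)).
Proof. by move=> a x y; congr pair; rewrite /= linearP. Qed.

Definition cover_pair : proj_cover (M1 * M2)%type.
Proof.
apply: (@Cover _ (cover_mod c1 * cover_mod c2)%type (cover_syz c1 * cover_syz c2)%type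
  (linmap (map2 (cover_inj c1) (cover_inj c2)))
  (linmap (map2 (cover_map c1) (cover_map c2)))).
- by apply: projective_pair; apply: cover_proj.
- by move=> [x y] [x' y'] /= [/cover_injP -> /cover_injP ->].
- rewrite -subTset => -[x y] _.
  have [x' _ <-] : range (cover_map c1) x by rewrite cover_surj.
  have [y' _ <-] : range (cover_map c2) y by rewrite cover_surj.
  by exists (x', y').
- apply/seteqP; split=> [[x y] [x0 y0]|_ [[x y] _ <-]] /=.
    have [x' _ <-] : range (cover_inj c1) x by rewrite -cover_exact.
    have [y' _ <-] : range (cover_inj c2) y by rewrite -cover_exact.
    by exists (x', y').
  have e1 : [set z | cover_map c1 z = 0] (cover_inj c1 x) by rewrite cover_exact; exists x.
  have e2 : [set z | cover_map c2 z = 0] (cover_inj c2 y) by rewrite cover_exact; exists y.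
  by congr pair.
Defined.

Lemma cover_pair_extends (N : lmodType R) (r : R) :
  (forall f : {linear cover_syz c1 -> N},
     exists g : {linear cover_mod c1 -> N}, forall x, g (cover_inj c1 x) = r *: f x) ->
  (forall f : {linear cover_syz c2 -> N},
     exists g : {linear cover_mod c2 -> N}, forall x, g (cover_inj c2 x) = r *: f x) ->
  forall f : {linear cover_syz cover_pair -> N},
    exists g : {linear cover_mod cover_pair -> N},
      forall x, g (cover_inj cover_pair x) = r *: f x.
Proof.
move=> ext1 ext2 f.
have [f1 [f2 fE]] := linear_pair_split f.
have [g1 g1E] := ext1 f1; have [g2 g2E] := ext2 f2.
have [g gE] := linear_pair_glue g1 g2.
by exists g => x; rewrite gE fE scalerDr g1E g2E.
Qed.

End PairCover.
End Covers.

(** * Coefficients and supports of power series *)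

Section FpsCoefficients.
Variable k : comNzRingType.
Implicit Types (f g : fps k) (S T U : pred nat).

Lemma fps_coef0 n : fps_coef (0 : fps k) n = 0. Proof. by []. Qed.
Lemma fps_coef1 n : fps_coef (1 : fps k) n = (n == 0)%:R. Proof. by []. Qed.
Lemma fps_coefD f g n : fps_coef (f + g) n = fps_coef f n + fps_coef g n.
Proof. by []. Qed.
Lemma fps_coefN f n : fps_coef (- f) n = - fps_coef f n. Proof. by []. Qed.
Lemma fps_coefZ (c : k) f n : fps_coef (c *: f) n = c * fps_coef f n.
Proof. by []. Qed.
Lemma fps_coefXn d n : fps_coef (fps_Xn k d) n = (n == d)%:R. Proof. by []. Qed.
Lemma fps_coefM f g n :
  fps_coef (f * g) n = \sum_(i < n.+1) fps_coef f i * fps_coef g (n - i).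
Proof. by []. Qed.

Lemma fps_coefXnM d f n :
  fps_coef (fps_Xn k d * f) n = if (n < d)%N then 0 else fps_coef f (n - d).
Proof.
rewrite fps_coefM; case: ltnP => dn.
  rewrite big1 // => i _; rewrite fps_coefXn.
  by rewrite (ltn_eqF (leq_ltn_trans (ltn_ord i : (i <= n)%N) dn)) mul0r.
rewrite (bigD1 (Ordinal (dn : (d < n.+1)%N))) //= eqxx mul1r big1 ?addr0 // => i.
by rewrite -val_eqE /= => /negbTE ->; rewrite mul0r.
Qed.

Definition fps_coefE := (fps_coef0, fps_coef1, fps_coefD, fps_coefN, fps_coefZ,
  fps_coefXn, fps_coefXnM).

Lemma fps_Xn0 : fps_Xn k 0 = 1. Proof. by []. Qed.

Lemma fps_XnD d e : fps_Xn k (d + e) = fps_Xn k d * fps_Xn k e.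
Proof.
apply: fpsP => n; rewrite !fps_coefE.
case: ltnP => [nd|dn]; last by rewrite -[in LHS](subnKC dn) eqn_add2l.
by rewrite (ltn_eqF (leq_trans nd (leq_addr e d))).
Qed.

Lemma fps_XnM_inj d : injective ( *%R (fps_Xn k d)).
Proof.
move=> f g fg; apply: fpsP => n.
have := congr1 (fun h => fps_coef h (d + n)) fg.
by rewrite !fps_coefXnM ltnNge leq_addr /= addKn.
Qed.

Definition fps_drop d f : fps k := Fps (fun n => fps_coef f (d + n)).

Lemma fps_dropK d f :
  (forall n, (n < d)%N -> fps_coef f n = 0) -> fps_Xn k d * fps_drop d f = f.
Proof.
move=> fd; apply: fpsP => n; rewrite fps_coefE.
by case: ltnP => [/fd ->|dn] //=; rewrite subnKC.
Qed.

(** Made boolean by [asbool], because the ring and the modules below are subtypes cut out by this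
    predicate. *)
Definition supp S : {pred fps k} :=
  fun f => `[< forall n, ~~ S n -> fps_coef f n = 0 >].

Lemma suppP S f : reflect (forall n, ~~ S n -> fps_coef f n = 0) (f \in supp S).
Proof. exact: asboolP. Qed.

Lemma supp0 S : 0 \in supp S. Proof. exact/suppP. Qed.

Lemma suppD S f g : f \in supp S -> g \in supp S -> f + g \in supp S.
Proof.
by move=> /suppP fS /suppP gS; apply/suppP => n Sn; rewrite fps_coefE fS ?gS ?addr0.
Qed.

Lemma suppN S f : f \in supp S -> - f \in supp S.
Proof. by move=> /suppP fS; apply/suppP => n Sn; rewrite fps_coefE fS ?oppr0. Qed.

Lemma suppZ S (c : k) f : f \in supp S -> c *: f \in supp S.
Proof. by move=> /suppP fS; apply/suppP => n Sn; rewrite fps_coefE fS ?mulr0. Qed.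

Lemma suppM S T U f g : (forall i j, S i -> T j -> U (i + j)%N) ->
  f \in supp S -> g \in supp T -> f * g \in supp U.
Proof.
move=> STU /suppP fS /suppP gT; apply/suppP => n Un; rewrite fps_coefM.
apply: big1 => i _; have [Si|/fS ->] := boolP (S i); last by rewrite mul0r.
have [Tj|/gT ->] := boolP (T (n - i)%N); last by rewrite mulr0.
by case/negP: Un; rewrite -(subnKC (ltn_ord i : (i <= n)%N)); apply: STU.
Qed.

Lemma suppXn S d : S d -> fps_Xn k d \in supp S.
Proof.
move=> Sd; apply/suppP => n Sn; rewrite fps_coefE.
by have [nd|//] := eqVneq n d; move: Sn; rewrite nd Sd.
Qed.

Lemma suppXnM S T d f : (forall n, S n -> T (d + n)%N) ->
  f \in supp S -> fps_Xn k d * f \in supp T.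
Proof.
move=> ST; apply: (@suppM (pred1 d) S) => [i j /eqP -> /ST //|].
exact/suppXn/eqxx.
Qed.

Lemma supp_sub S T f : (forall n, S n -> T n) -> f \in supp S -> f \in supp T.
Proof.
move=> ST /suppP fS; apply/suppP => n Tn; apply: fS.
by apply: contra Tn => /ST.
Qed.

End FpsCoefficients.

(** * Power series over a field form a domain *)

Section FpsField.
Variable k : fieldType.
Implicit Types f g : fps k.

(** Each coefficient of the inverse depends on all earlier ones, so the recursion returns the list
    of the first n + 1 of them. *)
Fixpoint fps_inv_seq f n : seq k :=
  if n is n'.+1 then
    let s := fps_inv_seq f n' in
    rcons s (- (fps_coef f 0)^-1 * \sum_(i < n'.+1) fps_coef f i.+1 * s`_(n' - i))
  else [:: (fps_coef f 0)^-1].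

Definition fps_inv_series f : fps k := Fps (fun n => (fps_inv_seq f n)`_n).

Lemma size_fps_inv_seq f n : size (fps_inv_seq f n) = n.+1.
Proof. by elim: n => //= n IH; rewrite size_rcons IH. Qed.

Lemma nth_fps_inv_seq f n i : (i <= n)%N -> (fps_inv_seq f n)`_i = (fps_inv_seq f i)`_i.
Proof.
elim: n => [|n IH]; first by rewrite leqn0 => /eqP ->.
move=> le_i; have [-> //|ne_i] := eqVneq i n.+1.
have lt_in : (i < n.+1)%N by rewrite ltn_neqAle ne_i.
by rewrite /= nth_rcons size_fps_inv_seq lt_in IH.
Qed.

Lemma fps_inv_seriesM f : fps_coef f 0 != 0 -> fps_inv_series f * f = 1.
Proof.
move=> f0; rewrite mulrC; apply: fpsP => -[|n].
  by rewrite fps_coefM big_ord1 /= mulfV.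
rewrite fps_coefM big_ord_recl subn0 [fps_coef (fps_inv_series f) n.+1]/=.
rewrite nth_rcons size_fps_inv_seq ltnn eqxx mulrA mulrN mulfV // mulN1r addrC.
apply/eqP; rewrite subr_eq0; apply/eqP; apply: eq_bigr => i _.
rewrite lift0 subSS [fps_coef (fps_inv_series f) _]/=.
by rewrite [in RHS]nth_fps_inv_seq ?leq_subr.
Qed.

Definition fps_unit : {pred fps k} := fun f => fps_coef f 0 != 0.

Definition fps_inv f := if f \in fps_unit then fps_inv_series f else f.

Fact fps_mulV : {in fps_unit, left_inverse 1 fps_inv *%R}.
Proof. by move=> f fu; rewrite /fps_inv fu fps_inv_seriesM. Qed.

Fact fps_unitP f g : g * f = 1 -> f \in fps_unit.
Proof.
move/(congr1 (fun h => fps_coef h 0)); rewrite fps_coefM big_ord1 /= => gf.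
apply/negP => /eqP f0; move: gf; rewrite f0 mulr0 => /esym /eqP.
by rewrite oner_eq0.
Qed.

Fact fps_inv_out : {in [predC fps_unit], fps_inv =1 id}.
Proof. by move=> f; rewrite /fps_inv inE /= => /negbTE ->. Qed.

HB.instance Definition _ :=
  GRing.ComNzRing_hasMulInverse.Build (fps k) fps_mulV fps_unitP fps_inv_out.

Lemma fps_unitE f : (f \is a GRing.unit) = (fps_coef f 0 != 0).
Proof. by []. Qed.

Lemma fps_order f : f != 0 -> exists d u, f = fps_Xn k d * u /\ u \is a GRing.unit.
Proof.
move=> f0; have exd : exists d, fps_coef f d != 0.
  apply: contrapT => h; case/eqP: f0; apply: fpsP => n.
  by apply/eqP/negPn/negP => fn; apply: h; exists n.
case: (ex_minnP exd) => d fd dmin; exists d, (fps_drop d f); split.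
  rewrite fps_dropK // => n nd; apply/eqP/negPn/negP => /dmin.
  by rewrite leqNgt nd.
by rewrite fps_unitE /= addn0.
Qed.

Fact fps_integral f g : f * g = 0 -> (f == 0) || (g == 0).
Proof.
have [//|/fps_order [d [u [-> uu]]]] := eqVneq f 0.
rewrite -mulrA -{1}[0](mulr0 (fps_Xn k d)) => /fps_XnM_inj ug.
by rewrite -(mulKr uu g) ug mulr0 eqxx orbT.
Qed.

HB.instance Definition _ := GRing.ComUnitRing_isIntegral.Build (fps k) fps_integral.

Lemma fps_Xn_neq0 d : fps_Xn k d != 0.
Proof.
apply/eqP => /(congr1 (fun f => fps_coef f d)) /eqP.
by rewrite !fps_coefE eqxx oner_eq0.
Qed.

End FpsField.

(** * The semigroup ring and its monomial modules *)

Definition sgH : pred nat := fun n => [|| n == 0, n == 5, n == 6 | 10 <= n]%N.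

Section TheRing.
Variable k : fieldType.

Fact supp_sgH_subalg : GRing.subalg_closed (supp sgH : {pred fps k}).
Proof.
split; first exact: suppXn.
- by move=> c f g fH gH; apply: suppD => //; apply: suppZ.
- by move=> f g; apply: suppM => i j; rewrite /sgH; lia.
Qed.

HB.instance Definition _ :=
  GRing.isSubalgClosed.Build k (fps k) (supp sgH) supp_sgH_subalg.

Record sring := SRing { ser : fps k; serP : ser \in supp sgH }.

HB.instance Definition _ := [isSub for ser].
HB.instance Definition _ := [Choice of sring by <:].
HB.instance Definition _ := [SubChoice_isSubComNzRing of sring by <:].
HB.instance Definition _ := [SubZmodule_isSubLmodule of sring by <:].
HB.instance Definition _ := [SubNzRing_SubLmodule_isSubLalgebra of sring by <:].
HB.instance Definition _ := [SubLalgebra_isSubAlgebra of sring by <:].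

HB.instance Definition _ := GRing.isZmodMorphism.Build sring (fps k) ser (fun _ _ => erefl).
HB.instance Definition _ :=
  GRing.isMonoidMorphism.Build sring (fps k) ser (erefl, fun _ _ => erefl).
HB.instance Definition _ := GRing.isScalable.Build k sring (fps k) _ ser (fun _ _ => erefl).

Lemma ser_inj : injective ser. Proof. exact: val_inj. Qed.

Lemma serD r s : ser (r + s) = ser r + ser s. Proof. by []. Qed.
Lemma serM r s : ser (r * s) = ser r * ser s. Proof. by []. Qed.
Lemma ser1 : ser 1 = 1. Proof. by []. Qed.

Definition to_sring (f : fps k) : sring := insubd 0 f.

Lemma to_sringK f : f \in supp sgH -> ser (to_sring f) = f.
Proof. exact: insubdK. Qed.

Lemma ser_coef0 r n : ~~ sgH n -> fps_coef (ser r) n = 0.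
Proof. by move: n; apply/suppP/serP. Qed.

(** A relative ideal of H in the nonnegative integers; [mono S] is then the fractional ideal of all
    series supported in [S]. *)
Record relideal := RelIdeal {
  rel :> pred nat;
  relP : forall h n, sgH h -> rel n -> rel (h + n)%N
}.

Record mono (S : relideal) := Mono { mser : fps k; mserP : mser \in supp S }.

Section MonoModule.
Variable S : relideal.

HB.instance Definition _ := [isSub for @mser S].
HB.instance Definition _ := [Choice of mono S by <:].

Fact supp_zmod : zmod_closed (supp S : {pred fps k}).
Proof.
split; first exact: supp0.
by move=> f g fS gS; apply: suppD => //; apply: suppN.
Qed.
HB.instance Definition _ :=
  GRing.SubChoice_isSubZmodule.Build _ _ (mono S) supp_zmod.

Fact mono_scale_subproof (r : sring) (x : mono S) : ser r * mser x \in supp S.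
Proof. by apply: suppM (serP r) (mserP x) => i j; apply: relP. Qed.

Definition mono_scale (r : sring) (x : mono S) := Mono (mono_scale_subproof r x).

Fact mono_scaleA a b x : mono_scale a (mono_scale b x) = mono_scale (a * b) x.
Proof. by apply: val_inj; rewrite /= mulrA. Qed.
Fact mono_scale1 : left_id 1 mono_scale.
Proof. by move=> x; apply: val_inj; rewrite /= mul1r. Qed.
Fact mono_scaleDr : right_distributive mono_scale +%R.
Proof. by move=> a x y; apply: val_inj; rewrite /= mulrDr. Qed.
Fact mono_scaleDl x : {morph mono_scale^~ x : a b / a + b}.
Proof. by move=> a b; apply: val_inj; rewrite /= mulrDl. Qed.

HB.instance Definition _ := GRing.Zmodule_isLmodule.Build sring (mono S)
  mono_scaleA mono_scale1 mono_scaleDr mono_scaleDl.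

Lemma mser_inj : injective (@mser S). Proof. exact: val_inj. Qed.

Lemma mserD x y : mser (x + y : mono S) = mser x + mser y. Proof. by []. Qed.
Lemma mserZ r (x : mono S) : mser (r *: x) = ser r * mser x. Proof. by []. Qed.

Lemma mser_coef0 (x : mono S) n : ~~ S n -> fps_coef (mser x) n = 0.
Proof. by move: n; apply/suppP/mserP. Qed.

End MonoModule.
End TheRing.

(** * Monomial covers of [N1] and [N2] *)

Section Restriction.
Variable k : fieldType.
Implicit Types f : fps k.

Definition fps_restrict (P : pred nat) f : fps k :=
  Fps (fun n => if P n then fps_coef f n else 0).

Lemma supp_restrict (P Q : pred nat) f : (forall n, P n -> Q n) ->
  fps_restrict P f \in supp Q.
Proof.
by move=> PQ; apply/suppP => n /=; case: ifP => // /PQ ->.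
Qed.

End Restriction.

Section Covers.
Variable k : fieldType.
Notation R := (sring k).
Notation X := (fps_Xn k).

Lemma projective_free3 : projective_module (R^o * R^o * R^o)%type.
Proof. by do 2?apply: projective_pair; exact: projective_regular. Qed.

Lemma projective_free4 : projective_module (R^o * R^o * R^o * R^o)%type.
Proof. by do 3?apply: projective_pair; exact: projective_regular. Qed.

Definition from_deg (d : nat) (S : pred nat) : pred nat := fun n => (d <= n)%N && S (n - d)%N.

Lemma supp_from_deg d S f : f \in supp (from_deg d S) ->
  exists2 u, u \in supp S & f = X d * u.
Proof.
move=> /suppP fS; exists (fps_drop d f).
  by apply/suppP => n Sn; rewrite /= fS // /from_deg addKn negb_and Sn orbT.
by rewrite fps_dropK // => n nd; rewrite fS // /from_deg leqNgt nd.
Qed.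

(* S is generated in degrees 0, a, b, c, and its syzygies are spanned by the binomial
   relations between the generator in degree 0 and one of the other three. *)
Section Star.
Variables (S T1 T2 T3 : relideal) (a b c : nat).
Hypothesis S_gen : forall n,
  S n = [|| sgH n, from_deg a sgH n, from_deg b sgH n | from_deg c sgH n].
Hypothesis T_sub : forall n, [/\ T1 n -> sgH (5 + n) && sgH (a + 5 + n),
  T2 n -> sgH (5 + n) && sgH (b + 5 + n) & T3 n -> sgH (5 + n) && sgH (c + 5 + n)]%N.
Hypothesis T1_sup : forall n, sgH n -> ~~ from_deg 5 T1 n ->
  ~~ [|| sgH (a + n), from_deg b sgH (a + n) | from_deg c sgH (a + n)]%N.
Hypothesis T2_sup : forall n, sgH n -> ~~ from_deg 5 T2 n ->
  ~~ [|| sgH (b + n), from_deg a sgH (b + n) | from_deg c sgH (b + n)]%N.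
Hypothesis T3_sup : forall n, sgH n -> ~~ from_deg 5 T3 n ->
  ~~ [|| sgH (c + n), from_deg a sgH (c + n) | from_deg b sgH (c + n)]%N.

Let F := (R^o * R^o * R^o * R^o)%type.
Let N := (mono k T1 * mono k T2 * mono k T3)%type.

Let pS (x : F) : ser x.1.1.1 + X a * ser x.1.1.2 + X b * ser x.1.2 + X c * ser x.2
  \in supp S.
Proof.
do !apply: suppD; try (apply: suppXnM (serP _) => n);
  try (apply: supp_sub (serP _) => n); rewrite S_gen /from_deg ?leq_addr ?addKn => -> //;
  by rewrite ?orbT.
Qed.

Let p (x : F) : mono k S := Mono (pS x).

Let p_lin : linear p.
Proof.
move=> r x y; apply: mser_inj.
rewrite /=; ring.
Qed.

Let j0 (x : N) :
  X (a + 5) * mser x.1.1 + X (b + 5) * mser x.1.2 + X (c + 5) * mser x.2 \in supp sgH.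
Proof.
by do !apply: suppD; apply: suppXnM (mserP _) => n; have [t1 t2 t3] := T_sub n;
  first [move=> /t1/andP[]|move=> /t2/andP[]|move=> /t3/andP[]].
Qed.
Let j1 (x : N) : - (X 5 * mser x.1.1) \in supp sgH.
Proof. by apply/suppN/suppXnM/mserP => n; have [+ _ _] := T_sub n => /[apply] /andP[]. Qed.
Let j2 (x : N) : - (X 5 * mser x.1.2) \in supp sgH.
Proof. by apply/suppN/suppXnM/mserP => n; have [_ + _] := T_sub n => /[apply] /andP[]. Qed.
Let j3 (x : N) : - (X 5 * mser x.2) \in supp sgH.
Proof. by apply/suppN/suppXnM/mserP => n; have [_ _ +] := T_sub n => /[apply] /andP[]. Qed.

Let j (x : N) : F := (SRing (j0 x), SRing (j1 x), SRing (j2 x), SRing (j3 x)).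

Let j_lin : linear j.
Proof.
move=> r x y.
by congr (_, _, _, _); apply: ser_inj; rewrite /=; ring.
Qed.

(** The hypotheses make 5 + T1 the set of n in H with a + n in H, and for the other n in H the
    degree a + n is reached by no generator but the one in degree a. So in a kernel element the
    coordinate at a is supported in 5 + T1. The same holds at b and c, and the coordinate at 0 is
    then forced. *)
Definition star_cover : proj_cover (mono k S).
Proof.
apply: (@Cover _ _ F N (linmap j_lin) (linmap p_lin)); first exact: projective_free4.
- have inj (T : relideal) (u v : mono k T) : - (X 5 * mser u) = - (X 5 * mser v) -> u = v.
    by move=> /oppr_inj /fps_XnM_inj /mser_inj.
  move=> x y jxy; have := congr1 (fun z : F => ser z.1.1.2) jxy => /inj.
  have := congr1 (fun z : F => ser z.1.2) jxy => /inj.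
  have := congr1 (fun z : F => ser z.2) jxy => /inj.
  by move: x y {jxy} => [[x1 x2] x3] [[y1 y2] y3] /= -> -> ->.
- rewrite -subTset => f _.
  (* Each degree of [f] is assigned to the first generator that reaches it, so the pieces do not
     overlap. *)
  pose P1 n := ~~ sgH n && from_deg a sgH n.
  pose P2 n := ~~ (sgH n || from_deg a sgH n) && from_deg b sgH n.
  pose P3 n := ~~ [|| sgH n, from_deg a sgH n | from_deg b sgH n] && from_deg c sgH n.
  have [u1 u1H e1] : exists2 u, u \in supp sgH & fps_restrict P1 (mser f) = X a * u.
    by apply/supp_from_deg/supp_restrict => n /andP[].
  have [u2 u2H e2] : exists2 u, u \in supp sgH & fps_restrict P2 (mser f) = X b * u.
    by apply/supp_from_deg/supp_restrict => n /andP[].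
  have [u3 u3H e3] : exists2 u, u \in supp sgH & fps_restrict P3 (mser f) = X c * u.
    by apply/supp_from_deg/supp_restrict => n /andP[].
  have u0H : fps_restrict sgH (mser f) \in supp sgH by exact: supp_restrict.
  exists (SRing u0H, SRing u1H, SRing u2H, SRing u3H) => //.
  apply: mser_inj; rewrite /= -e1 -e2 -e3; apply: fpsP => n; rewrite !fps_coefD /= /P1 /P2 /P3.
  have := @mser_coef0 _ _ f n; rewrite S_gen.
  by case: (sgH n) (from_deg a sgH n) (from_deg b sgH n) (from_deg c sgH n)
    => [] [] [] [] /=; rewrite ?addr0 ?add0r // => ->.
- apply/seteqP; split=> [[[[r0 r1] r2] r3] /(congr1 (@mser _ _)) /= p0|_ [x _ <-]]; last first.
    apply: mser_inj; rewrite /= !fps_XnD; ring.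
  have co n := congr1 (fun f => fps_coef f n) p0.
  have sh d (r : R) n : ~~ from_deg d sgH n -> fps_coef (X d * ser r) n = 0.
    by apply/suppP/suppXnM/serP => m; rewrite /from_deg leq_addr addKn.
  have own d (r : R) n : fps_coef (X d * ser r) (d + n) = fps_coef (ser r) n.
    by rewrite fps_coefXnM ltnNge leq_addr addKn.
  have [u1 u1T e1] : exists2 u, u \in supp T1 & ser r1 = X 5 * u.
    apply/supp_from_deg/suppP => n nT; have [nH|nH] := boolP (sgH n); last exact: ser_coef0.
    have /norP[h0 /norP[hb hc]] := T1_sup nH nT.
    have := co (a + n)%N; rewrite !fps_coefD own.
    by rewrite (ser_coef0 r0 h0) (sh _ _ _ hb) (sh _ _ _ hc) add0r !addr0.
  have [u2 u2T e2] : exists2 u, u \in supp T2 & ser r2 = X 5 * u.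
    apply/supp_from_deg/suppP => n nT; have [nH|nH] := boolP (sgH n); last exact: ser_coef0.
    have /norP[h0 /norP[hb hc]] := T2_sup nH nT.
    have := co (b + n)%N; rewrite !fps_coefD own.
    by rewrite (ser_coef0 r0 h0) (sh _ _ _ hb) (sh _ _ _ hc) !add0r addr0.
  have [u3 u3T e3] : exists2 u, u \in supp T3 & ser r3 = X 5 * u.
    apply/supp_from_deg/suppP => n nT; have [nH|nH] := boolP (sgH n); last exact: ser_coef0.
    have /norP[h0 /norP[hb hc]] := T3_sup nH nT.
    have := co (c + n)%N; rewrite !fps_coefD own.
    by rewrite (ser_coef0 r0 h0) (sh _ _ _ hb) (sh _ _ _ hc) !add0r.
  exists (- Mono u1T, - Mono u2T, - Mono u3T) => //.
  congr (_, _, _, _); apply: ser_inj; rewrite /= ?mulrN ?opprK //.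
  move: p0; rewrite e1 e2 e3 !fps_XnD => p0.
  apply/eqP; rewrite -subr_eq0 -oppr_eq0 -[X in _ == X]p0; apply/eqP; ring.
Defined.

End Star.


Definition maxI : set R := [set r | fps_coef (ser r) 0 = 0].

Definition N1 : relideal.
Proof. by exists (fun n => (n == 0) || (5 <= n))%N => h n; rewrite /sgH; lia. Defined.

Definition N2 : relideal.
Proof. by exists (fun n => (n <= 1) || (5 <= n))%N => h n; rewrite /sgH; lia. Defined.

Definition W : relideal.
Proof.
by exists (fun n => [|| n <= 2, 5 <= n <= 8 | 10 <= n])%N => h n; rewrite /sgH; lia.
Defined.

Lemma maxI_shift r : maxI r -> exists2 u, u \in supp N2 & ser r = X 5 * u.
Proof.
move=> r0; apply/supp_from_deg/suppP => n nN2.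
have [->|n0] := eqVneq n 0%N; first exact: r0.
by apply: ser_coef0; move: nN2 n0; rewrite /from_deg /N2 /sgH /=; lia.
Qed.

Section Homomorphisms.
Variables (S : relideal) (f : mono k S -> fps k).
Hypothesis fZ : forall (r : R) u, f (r *: u) = ser r * f u.

(** So [f] is multiplication by a fraction. As t^10 k[[t]] lies in [R], the factor t^10 turns [u]
    and [w] into scalars to which linearity applies. *)
Lemma mono_hom_sym u w : mser w * f u = mser u * f w.
Proof.
have x10 (v : mono k S) : X 10 * mser v \in supp sgH.
  by apply: suppXnM (mserP v) => n _; rewrite /sgH leq_addr !orbT.
apply: (@fps_XnM_inj _ 10); rewrite /= !mulrA.
rewrite -[X 10 * mser w]/(ser (SRing (x10 w))) -[X 10 * mser u]/(ser (SRing (x10 u))).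
rewrite -!fZ; congr f; apply: mser_inj; rewrite /=; ring.
Qed.

End Homomorphisms.

Lemma hom_N2 (f : {linear mono k N2 -> R^o}) r : maxI r ->
  exists y : R, forall u, ser r * ser (f u) = X 5 * mser u * ser y.
Proof.
move=> /maxI_shift [v vN2 rE]; exists (f (Mono vN2)) => u.
have fZ (s : R) w : ser (f (s *: w)) = ser s * ser (f w) by rewrite linearZ.
by rewrite rE -!mulrA; congr (_ * _); rewrite -[v]/(mser (Mono vN2)) (mono_hom_sym fZ).
Qed.

Lemma hom_N1 (f : {linear mono k N1 -> R^o}) :
  exists2 q : R, maxI q & forall u, ser (f u) = mser u * ser q.
Proof.
have fZ (s : R) w : ser (f (s *: w)) = ser s * ser (f w) by rewrite linearZ.
have one : (1 : fps k) \in supp N1 by exact: (@suppXn k N1 0).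
have x7 : X 7 \in supp N1 by exact: suppXn.
have fE u : ser (f u) = mser u * ser (f (Mono one)).
  by rewrite -(mono_hom_sym fZ) mul1r.
exists (f (Mono one)) => //.
(* The constant term of q is the coefficient of t^7 in f(t^7) = t^7 q, and 7 is a gap of H. *)
have : fps_coef (ser (f (Mono x7))) 7 = fps_coef (X 7 * ser (f (Mono one))) 7.
  by rewrite fE.
by rewrite fps_coefXnM (ser_coef0 (f (Mono x7))) // => /esym.
Qed.

(** These are the degrees 10 + N2 + N2 of m^2; among them only 12 is outside 5 + H. *)
Lemma maxI_prod r q : maxI r -> maxI q ->
  ser r * ser q \in supp (fun n => (10 <= n <= 12) || (15 <= n))%N.
Proof.
move=> /maxI_shift [u uN2 ->] /maxI_shift [v vN2 ->].
rewrite mulrACA -fps_XnD.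
apply: (@suppXnM _ (fun n => (n <= 2) || (5 <= n))%N) => [n|]; first by lia.
by apply: suppM uN2 vN2 => i j /=; lia.
Qed.

(** This is m Ext^1(M, R) = 0, expressed on one cover. *)
Definition ext_extends (M : lmodType R) (c : proj_cover M) : Prop :=
  forall (r : R) (f : {linear cover_syz c -> R^o}), maxI r ->
  exists g : {linear cover_mod c -> R^o}, forall x, g (cover_inj c x) = r *: f x.

(** The generators 7, 8, 9 are gaps which every positive element of H moves into H; this makes all
    three syzygies N2. *)
Definition coverN1 : proj_cover (mono k N1).
Proof.
by apply: (@star_cover N1 N2 N2 N2 7 8 9) => n; rewrite /from_deg /sgH /=; try split; lia.
Defined.

(** At the leaf in degree 1, 5 + 1 is in H but 6 + 1 is not; hence N1 there instead of N2. *)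
Definition coverN2 : proj_cover (mono k N2).
Proof.
by apply: (@star_cover N2 N1 N2 N2 1 8 9) => n; rewrite /from_deg /sgH /=; try split; lia.
Defined.

Lemma hom_free4 (y0 y1 y2 y3 : R) : exists g : {linear (R^o * R^o * R^o * R^o)%type -> R^o},
  forall x, ser (g x) =
    ser x.1.1.1 * ser y0 + ser x.1.1.2 * ser y1 + ser x.1.2 * ser y2 + ser x.2 * ser y3.
Proof.
have [|g gE] := @exists_linear _ (R^o * R^o * R^o * R^o)%type R^o
  (fun x => x.1.1.1 * y0 + x.1.1.2 * y1 + x.1.2 * y2 + x.2 * y3).
  by move=> a x y; apply: ser_inj; rewrite /=; ring.
by exists g => x; rewrite gE.
Qed.

Lemma coverN1_extends : ext_extends coverN1.
Proof.
move=> r f mr; have [f12 [f3 fE]] := linear_pair_split f.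
have [f1 [f2 f12E]] := linear_pair_split f12.
have [y1 y1E] := hom_N2 f1 mr; have [y2 y2E] := hom_N2 f2 mr.
have [y3 y3E] := hom_N2 f3 mr.
have [g gE] := hom_free4 0 (- y1) (- y2) (- y3).
exists g => x; apply: ser_inj.
transitivity (ser r * ser (f1 x.1.1) + ser r * ser (f2 x.1.2) + ser r * ser (f3 x.2)).
  by rewrite gE y1E y2E y3E /=; ring.
by rewrite fE f12E /=; ring.
Qed.

Lemma coverN2_extends : ext_extends coverN2.
Proof.
move=> r f mr; have [f12 [f3 fE]] := linear_pair_split f.
have [f1 [f2 f12E]] := linear_pair_split f12.
have [q mq qE] := hom_N1 f1.
have [y2 y2E] := hom_N2 f2 mr; have [y3 y3E] := hom_N2 f3 mr.
have /suppP rqP := maxI_prod mr mq.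
(* On the summand N1 the equation is t^6 y0 - t^5 y1 = r q. Taking y0 = c t^6 removes degree 12, and
   the rest is divisible by t^5 in [R]. *)
pose c := fps_coef (ser r * ser q) 12.
have y0H : c *: X 6 \in supp sgH by apply/suppZ/suppXn.
(* At the leaves in degrees 8 and 9 this y0 contributes t^13 y0 and t^14 y0; the values t^8 y0 and
   t^9 y0 there cancel them against the entries -t^5. *)
have s8 : X 8 * (c *: X 6) \in supp sgH.
  by rewrite -scalerAr -fps_XnD; apply/suppZ/suppXn.
have s9 : X 9 * (c *: X 6) \in supp sgH.
  by rewrite -scalerAr -fps_XnD; apply/suppZ/suppXn.
have [y1 y1H y1E] : exists2 y, y \in supp sgH &
    X 6 * (c *: X 6) - ser r * ser q = X 5 * y.
  apply/supp_from_deg/suppP => n; rewrite -scalerAr -fps_XnD /from_deg => nH.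
  rewrite !fps_coefE; have [->|n12] := eqVneq n 12%N; first by rewrite mulr1 subrr.
  by rewrite mulr0 add0r rqP ?oppr0 //; move: nH n12; rewrite /sgH; lia.
have [g gE] := hom_free4 (SRing y0H) (SRing y1H)
  (SRing s8 - y2) (SRing s9 - y3).
exists g => x; apply: ser_inj.
transitivity (ser r * ser (f1 x.1.1) + ser r * ser (f2 x.1.2) + ser r * ser (f3 x.2)).
  rewrite gE y2E y3E qE /= !fps_XnD.
  have -> : ser r * (mser x.1.1 * ser q) = mser x.1.1 * (X 6 * (c *: X 6) - X 5 * y1).
    by rewrite -y1E; ring.
  rewrite (fps_XnD k 1 5); ring.
by rewrite fE f12E /=; ring.
Qed.

End Covers.

(** * The cover of omega and the annihilation of Ext *)

Section CanonicalCover.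
Variable k : fieldType.
Notation R := (sring k).
Notation X := (fps_Xn k).

Let F := (R^o * R^o * R^o)%type.
Let N := (mono k N1 * mono k N1)%type.

Let pS (x : F) : ser x.1.1 + X 1 * ser x.1.2 + X 2 * ser x.2 \in supp W.
Proof.
do !apply: suppD; try (apply: suppXnM (serP _) => n);
  try (apply: supp_sub (serP _) => n); rewrite /sgH /W /=; lia.
Qed.

Let p (x : F) : mono k W := Mono (pS x).

Let p_lin : linear p.
Proof. move=> r x y; apply: mser_inj; rewrite /=; ring. Qed.

Let j0 (x : N) : X 6 * mser x.1 \in supp sgH.
Proof. by apply/suppXnM/mserP => n; rewrite /sgH /N1 /=; lia. Qed.
Let j1 (x : N) : - (X 5 * mser x.1) + X 6 * mser x.2 \in supp sgH.
Proof.
by apply: suppD; [apply: suppN|]; apply/suppXnM/mserP => n; rewrite /sgH /N1 /=; lia.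
Qed.
Let j2 (x : N) : - (X 5 * mser x.2) \in supp sgH.
Proof. by apply/suppN/suppXnM/mserP => n; rewrite /sgH /N1 /=; lia. Qed.

Let j (x : N) : F := (SRing (j0 x), SRing (j1 x), SRing (j2 x)).

Let j_lin : linear j.
Proof.
by move=> r x y; congr (_, _, _); apply: ser_inj; rewrite /=; ring.
Qed.

Definition coverW : proj_cover (mono k W).
Proof.
apply: (@Cover _ _ F N (linmap j_lin) (linmap p_lin)); first exact: projective_free3.
- move=> x y jxy; have := congr1 (fun z : F => ser z.1.1) jxy => /fps_XnM_inj /mser_inj.
  have := congr1 (fun z : F => ser z.2) jxy => /oppr_inj /fps_XnM_inj /mser_inj.
  by move: x y {jxy} => [x1 x2] [y1 y2] /= -> ->.
- rewrite -subTset => f _.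
  pose P1 n := ~~ sgH n && from_deg 1 sgH n.
  pose P2 n := ~~ (sgH n || from_deg 1 sgH n) && from_deg 2 sgH n.
  have [u1 u1H e1] : exists2 u, u \in supp sgH & fps_restrict P1 (mser f) = X 1 * u.
    by apply/supp_from_deg/supp_restrict => n /andP[].
  have [u2 u2H e2] : exists2 u, u \in supp sgH & fps_restrict P2 (mser f) = X 2 * u.
    by apply/supp_from_deg/supp_restrict => n /andP[].
  have u0H : fps_restrict sgH (mser f) \in supp sgH by exact: supp_restrict.
  exists (SRing u0H, SRing u1H, SRing u2H) => //.
  apply: mser_inj; rewrite /= -e1 -e2; apply: fpsP => n; rewrite !fps_coefD /= /P1 /P2.
  have W_gen : W n = [|| sgH n, from_deg 1 sgH n | from_deg 2 sgH n].
    by rewrite /W /from_deg /sgH /=; lia.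
  have := @mser_coef0 _ _ f n; rewrite W_gen.
  by case: (sgH n) (from_deg 1 sgH n) (from_deg 2 sgH n)
    => [] [] [] /=; rewrite ?addr0 ?add0r // => ->.
- apply/seteqP; split=> [[[r0 r1] r2] /(congr1 (@mser _ _)) /= p0|_ [x _ <-]]; last first.
    by apply: mser_inj; rewrite /= (fps_XnD k 1 5) (fps_XnD k 1 1); ring.
  have co n := congr1 (fun f => fps_coef f n) p0.
  have sh d (r : R) n : ~~ from_deg d sgH n -> fps_coef (X d * ser r) n = 0.
    by apply/suppP/suppXnM/serP => m; rewrite /from_deg leq_addr addKn.
  have [u uN e0] : exists2 u, u \in supp N1 & ser r0 = X 6 * u.
    apply/supp_from_deg/suppP => n nT; have [nH|nH] := boolP (sgH n); last exact: ser_coef0.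
    have := co n; rewrite !fps_coefD (sh 1%N) ?(sh 2) ?addr0 //;
    by move: nT nH; rewrite /from_deg /sgH /N1 /=; lia.
  have [v vN e2] : exists2 u, u \in supp N1 & ser r2 = X 5 * u.
    apply/supp_from_deg/suppP => n nT; have [nH|nH] := boolP (sgH n); last exact: ser_coef0.
    have := co (2 + n)%N; rewrite !fps_coefD (sh 1%N) ?(ser_coef0 r0) ?add0r.
    + by rewrite fps_coefXnM /= subn2.
    + by move: nT nH; rewrite /from_deg /sgH /N1 /=; lia.
    + by move: nT nH; rewrite /from_deg /sgH /N1 /=; lia.
  exists (Mono uN, - Mono vN) => //.
  congr (_, _, _); apply: ser_inj; rewrite /= ?mulrN ?opprK //.
  (* The middle coordinate is determined by t r1 = - r0 - t^2 r2, after cancelling t. *)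
  apply: (@fps_XnM_inj _ 1).
  apply/eqP; rewrite -subr_eq0 -oppr_eq0 -[_ == 0]/(_ == 0 :> fps k) -[X in _ == X]p0 e0 e2.
  by rewrite (fps_XnD k 1 5) (fps_XnD k 1 1); apply/eqP; ring.
Defined.

(** The generators 1, t, t^2 form a path, so with A = r q1 and B = r q2 one has to solve A = t^6 y0
    - t^5 y1 and B = t^6 y1 - t^5 y2, the same y1 serving both edges. What a term of y1 meant for
    one equation adds to the other has degree 11 or 16, and both lie in 5 + H and in 6 + H. *)
Lemma coverW_extends : ext_extends coverW.
Proof.
move=> r f mr; have [f1 [f2 fE]] := linear_pair_split f.
have [q1 mq1 q1E] := hom_N1 f1; have [q2 mq2 q2E] := hom_N1 f2.
have /suppP := maxI_prod mr mq1; have /suppP := maxI_prod mr mq2.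
set A := ser r * ser q1; set B := ser r * ser q2 => BP AP.
(* y1 supplies the coefficients of A that t^6 y0 cannot reach, and those of B
   that t^5 y2 cannot reach. *)
pose y1 := fps_coef B 12 *: X 6 - fps_coef A 10 *: X 5 - fps_coef A 15 *: X 10.
have y1H : y1 \in supp sgH.
  by do !apply: suppD; rewrite -?scaleNr; apply/suppZ/suppXn.
have [y0 y0H y0E] : exists2 y, y \in supp sgH & A + X 5 * y1 = X 6 * y.
  apply/supp_from_deg/suppP => n nH.
  have := AP n; rewrite /y1 !fps_coefE.
  have [->|n10] := eqVneq n 10%N.
    by rewrite /= !mulr0 !mulr1 sub0r subr0 subrr.
  have [->|n15] := eqVneq n 15%N.
    by rewrite /= !mulr0 !mulr1 !sub0r oppr0 add0r subrr.
  have n11 : n != 11%N by apply: contra nH => /eqP ->.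
  move=> ->; last by move: nH n10 n15; rewrite /from_deg /sgH; lia.
  case: ltnP => n5; rewrite ?addr0 //.
  have -> : (n - 5 == 6)%N = false by move: n10 n11 n15; lia.
  have -> : (n - 5 == 5)%N = false by move: n10 n11 n15; lia.
  have -> : (n - 5 == 10)%N = false by move: n10 n11 n15; lia.
  by rewrite !mulr0 !subr0 addr0.
have [y2 y2H y2E] : exists2 y, y \in supp sgH & X 6 * y1 - B = X 5 * y.
  apply/supp_from_deg/suppP => n nH.
  have := BP n; rewrite /y1 !fps_coefE.
  have [->|n12] := eqVneq n 12%N.
    by rewrite /= !mulr0 !mulr1 !subr0 subrr.
  have n11 : n != 11%N by apply: contra nH => /eqP ->.
  have n16 : n != 16%N by apply: contra nH => /eqP ->.
  move=> ->; last by move: nH n12; rewrite /from_deg /sgH; lia.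
  case: ltnP => n6; rewrite ?subr0 //.
  have -> : (n - 6 == 6)%N = false by move: n11 n12 n16; lia.
  have -> : (n - 6 == 5)%N = false by move: n11 n12 n16; lia.
  have -> : (n - 6 == 10)%N = false by move: n11 n12 n16; lia.
  by rewrite !mulr0 !subr0.
have [|g gE] := @exists_linear _ (R^o * R^o * R^o)%type R^o
  (fun x => x.1.1 * SRing y0H + x.1.2 * SRing y1H + x.2 * SRing y2H).
  by move=> a x y; apply: ser_inj; rewrite /=; ring.
exists g => x; apply: ser_inj.
transitivity (mser x.1 * A + mser x.2 * B).
  have -> : A = X 6 * y0 - X 5 * y1 by rewrite -y0E; ring.
  have -> : B = X 6 * y1 - X 5 * y2 by rewrite -y2E; ring.
  by rewrite gE /=; ring.
by rewrite fE /= q1E q2E /A /B; ring.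
Qed.

(** The syzygies of the covers above are literally such products, so nothing has to be transported
    along isomorphisms. *)
Inductive syzygy_class : lmodType R -> Prop :=
| syzygy_N1 : syzygy_class (mono k N1)
| syzygy_N2 : syzygy_class (mono k N2)
| syzygy_pair M1 M2 : syzygy_class M1 -> syzygy_class M2 -> syzygy_class (M1 * M2)%type.

Lemma syzygy_class_cover M : syzygy_class M ->
  exists c : proj_cover M, syzygy_class (cover_syz c) /\ ext_extends c.
Proof.
elim=> [||M1 M2 _ [c1 [s1 e1]] _ [c2 [s2 e2]]].
- by exists (coverN1 k); split; [do !constructor|exact: coverN1_extends].
- by exists (coverN2 k); split; [do !constructor|exact: coverN2_extends].
- exists (cover_pair c1 c2); split; first exact: syzygy_pair.
  by move=> r f mr; apply: cover_pair_extends => g; [exact: e1|exact: e2].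
Qed.

Lemma annihilates_Ext_W i :
  (0 < i)%N -> annihilates_Ext (@maxI k) i (mono k W) (R^o : lmodType R).
Proof.
case: i => // i _.
have SW : syzygy_class (cover_syz coverW) by do !constructor.
apply: (annihilates_Ext_of_covers syzygy_class_cover SW coverW_extends) => L c ec r f mr.
exact: ec.
Qed.

End CanonicalCover.

(** * Locality, Bass numbers and the trace of omega *)

Section Local.
Variable k : fieldType.
Notation R := (sring k).
Notation X := (fps_Xn k).
Notation maxI := (@maxI k).

Lemma fps_coef_sum (I : Type) (s : seq I) (P : pred I) (F : I -> fps k) n :
  fps_coef (\sum_(i <- s | P i) F i) n = \sum_(i <- s | P i) fps_coef (F i) n.
Proof. by elim/big_rec2: _ => // i x y _ <-. Qed.

Lemma ser_coef0M (r s : R) :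
  fps_coef (ser (r * s)) 0 = fps_coef (ser r) 0 * fps_coef (ser s) 0.
Proof. by rewrite /= big_ord1. Qed.

Lemma maxI_ideal : is_ideal maxI.
Proof.
split=> [//|x y x0 y0|r x x0].
  by rewrite /maxI /= x0 y0 addr0.
have e : fps_coef (ser x) 0 = 0 := x0.
by change (fps_coef (ser (r * x)) 0 = 0); rewrite ser_coef0M e mulr0.
Qed.

(** The inverse u in k[[t]] satisfies c u = 1 - t^5 w u with w supported in N2. This first excludes
    degrees 1 to 4 from u; knowing that, w u is supported in N2, so t^5 w u and then u lie in
    [R]. *)
Lemma inverse_mod_maxI (r : R) : ~ maxI r -> exists s, s * r = 1.
Proof.
move=> /eqP r0; pose c := fps_coef (ser r) 0; pose u := fps_inv_series (ser r).
have ur : u * ser r = 1 by exact: fps_inv_seriesM.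
have rcm : maxI (r - c *: 1) by rewrite /maxI /= mulr1 subrr.
have [w wN2 rE] := maxI_shift rcm.
have cu : c *: u = 1 - X 5 * (w * u).
  rewrite -ur mulrA -rE [ser _]/= mulrBl mulrC opprB addrC subrK.
  by rewrite -scalerAl mul1r.
have uE n : fps_coef u n = c^-1 * fps_coef (1 - X 5 * (w * u)) n.
  by rewrite -cu fps_coefZ mulKf.
have uN1 : u \in supp N1.
  apply/suppP => n nN1; rewrite uE !fps_coefE (_ : (n == 0)%N = false).
    by rewrite (_ : (n < 5)%N) ?subr0 ?mulr0 //; move: nN1; rewrite /N1 /=; lia.
  by move: nN1; rewrite /N1 /=; lia.
have uH : u \in supp sgH.
  rewrite -[u](scalerK r0) -/c cu; apply: suppZ; apply: suppD.
    exact: (@suppXn k sgH 0).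
  apply/suppN/(@suppXnM _ N2) => [n|]; first by rewrite /N2 /sgH /=; lia.
  by apply: suppM wN2 uN1 => i j; rewrite /N1 /N2 /=; lia.
by exists (SRing uH); apply: ser_inj.
Qed.

Lemma maxI_proper : ~ maxI 1.
Proof. by rewrite /maxI /= => /eqP; rewrite oner_eq0. Qed.

Lemma sub_maxI (I : set R) : is_ideal I -> I <> setT -> I `<=` maxI.
Proof.
move=> [I0 ID IM] IT r Ir; apply: contrapT => /inverse_mod_maxI [s sr].
apply: IT; rewrite -subTset => x _; rewrite -[x]mulr1 -sr mulrA; exact: IM.
Qed.

Lemma maximal_idealE (I : set R) : maximal_ideal I -> I = maxI.
Proof.
move=> [II IT Imax]; have [//|mT] := Imax _ maxI_ideal (sub_maxI II IT).
by case: maxI_proper; rewrite mT.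
Qed.

Definition residue_field : Type := k.
HB.instance Definition _ := GRing.Zmodule.on residue_field.

Definition residue_scale (r : R) (c : residue_field) : residue_field :=
  fps_coef (ser r) 0 * (c : k).

Fact residue_scaleA a b c : residue_scale a (residue_scale b c) = residue_scale (a * b) c.
Proof. by rewrite /residue_scale ser_coef0M mulrA. Qed.
Fact residue_scale1 : left_id 1 residue_scale.
Proof. by move=> c; exact: mul1r. Qed.
Fact residue_scaleDr : right_distributive residue_scale +%R.
Proof. by move=> a x y; exact: mulrDr. Qed.
Fact residue_scaleDl c : {morph residue_scale^~ c : a b / a + b}.
Proof. by move=> a b; exact: mulrDl. Qed.

HB.instance Definition _ := GRing.Zmodule_isLmodule.Build R residue_field
  residue_scaleA residue_scale1 residue_scaleDr residue_scaleDl.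

Let res (r : R^o) : residue_field := fps_coef (ser r) 0.

Let res_lin : linear res.
Proof. by move=> a x y; rewrite /res /= big_ord1. Qed.

Let res_surj : range res = setT.
Proof.
by rewrite -subTset => c _; exists ((c : k) *: (1 : R)) => //; rewrite /res /= mulr1.
Qed.

Lemma residue_quotient : quotient_module maxI residue_field.
Proof. by exists (linmap res_lin); split; first exact: res_surj. Qed.

Let incl_sub (u : mono k N2) : X 5 * mser u \in supp sgH.
Proof. by apply: suppXnM (mserP u) => n; rewrite /N2 /sgH /=; lia. Qed.

Let incl (u : mono k N2) : R^o := SRing (incl_sub u).

Let incl_lin : linear incl.
Proof. by move=> a x y; apply: ser_inj; rewrite /=; ring. Qed.

(** The sequence 0 -> m -> R -> k -> 0, with m written as t^5 N2 to stay inside [syzygy_class]. *)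
Definition residue_cover : proj_cover residue_field.
Proof.
apply: (@Cover _ _ _ _ (linmap incl_lin) (linmap res_lin)).
- exact: projective_regular.
- by move=> x y /(congr1 (@ser k)) /fps_XnM_inj /mser_inj.
- exact: res_surj.
- apply/seteqP; split=> [r /maxI_shift [u uN2 rE]|_ [u _ <-]].
    by exists (Mono uN2) => //; apply: ser_inj.
  by rewrite /= /res [LHS]fps_coefXnM.
Defined.

Lemma residue_syzygy : syzygy_class (cover_syz residue_cover).
Proof. exact: syzygy_N2. Qed.

Lemma residue_extends : ext_extends residue_cover.
Proof.
move=> r f mr; have [y yE] := hom_N2 f mr.
have [|g gE] := @exists_linear _ R^o R^o (fun s => s * y).
  by move=> a s t; apply: ser_inj; rewrite /=; ring.
by exists g => u; apply: ser_inj; rewrite gE; exact: esym (yE u).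
Qed.

HB.instance Definition _ (S : relideal) :=
  GRing.isZmodMorphism.Build (mono k S) (fps k) (@mser k S) (fun _ _ => erefl).

(* V will be R or omega, v its inclusion in k[[t]], T its value set. *)
Section BassNumbers.
Variables (V : lmodType R) (v : {additive V -> fps k}) (T : pred nat).
Hypothesis vZ : forall (r : R) x, v (r *: x) = ser r * v x.
Hypothesis v_inj : injective v.
Hypothesis v_supp : forall x, v x \in supp T.
Hypothesis v_surj : forall f, f \in supp T -> exists x, v x = f.

(** Multiplication by t^5 is zero on the residue field and injective on [V]. *)
Lemma bass_number0_zero : bass_number maxI 0 V 0.
Proof.
apply: (bass_number0_of_cover (@syzygy_class_cover k) residue_syzygy residue_extends
  residue_quotient) => f x.
have x5 : X 5 \in supp sgH by exact: suppXn.
apply: v_inj; rewrite raddf0; apply: (@fps_XnM_inj _ 5); rewrite mulr0.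
rewrite -[X 5]/(ser (SRing x5)) -vZ -linearZ.
by rewrite (_ : _ *: x = 0) ?linear0 ?raddf0 //; exact: mul0r.
Qed.

(* Hom(m, V) is the set of s in k((t)) with s m contained in V; the substitution
   m = t^5 N2 shifts all degrees by 5. *)
Variables (l : nat) (e : 'I_l -> nat).
Hypothesis e_inj : injective e.
Hypothesis T_hom : forall n, T n -> T (1 + n)%N -> T (8 + n)%N -> T (9 + n)%N ->
  from_deg 5 T n || [exists j, n == e j].
Hypothesis T_e : forall j n, N2 n -> T (e j + n)%N.
Hypothesis e_notin : forall j, ~~ from_deg 5 T (e j).
Hypothesis e_max : forall j n, sgH n -> n != 0%N -> from_deg 5 T (e j + n).
Hypothesis e_indep : forall i j, i != j -> ~~ from_deg (e i) sgH (e j).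

(** A map N2 -> V is multiplication by some p with p N2 in V, and the maps coming from R -> V are
    those with p in t^5 V. The quotient has the basis t^(e j). [T_hom] tests p on the generators of
    N2, in degrees 0, 1, 8, 9. *)
Lemma bass_number1_degrees : bass_number maxI 1 V l.
Proof.
have scaleV (x : V) : exists g : {linear R^o -> V}, forall s, g s = s *: x.
  by apply: exists_linear => a s t; rewrite scalerDl -scalerA.
have /choice [b bE] j : exists b : {linear mono k N2 -> V},
    forall u, v (b u) = X (e j) * mser u.
  have /choice [h hE] (u : mono k N2) : exists x, v x = X (e j) * mser u.
    by apply/v_surj/suppXnM/mserP => n; apply: T_e.
  have [|g gE] := @exists_linear _ (mono k N2) V h.
    by move=> a x y; apply: v_inj; rewrite raddfD vZ !hE /=; ring.
  by exists g => u; rewrite gE hE.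
have vbE (r : 'I_l -> R) u :
    v (\sum_j r j *: b j u) = (\sum_j ser (r j) * X (e j)) * mser u.
  rewrite raddf_sum mulr_suml; apply: eq_bigr => j _.
  by rewrite vZ bE mulrA.
apply: (bass_number1_of_cover (@syzygy_class_cover k) residue_syzygy residue_extends
  (b := b) residue_quotient) => [f|r].
- have fZ (s : R) u : v (f (s *: u)) = ser s * v (f u) by rewrite linearZ vZ.
  have mono_in d : N2 d -> X d \in supp N2 by exact: suppXn.
  pose p := v (f (Mono (mono_in 0%N isT))).
  have fE u : v (f u) = mser u * p by rewrite -(mono_hom_sym fZ) mul1r.
  have pT d : N2 d -> forall n, ~~ T (d + n)%N -> fps_coef p n = 0.
    move=> Nd n Tn; have /suppP /(_ _ Tn) := v_supp (f (Mono (mono_in d Nd))).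
    by rewrite fE fps_coefXnM ltnNge leq_addr addKn.
  pose r j : R := fps_coef p (e j) *: 1.
  have rE : \sum_j ser (r j) * X (e j) = \sum_j fps_coef p (e j) *: X (e j).
    by apply: eq_bigr => j _; rewrite -[ser (r j)]/(_ *: 1) -scalerAl mul1r.
  have [y yT yE] : exists2 y, y \in supp T & p - \sum_j fps_coef p (e j) *: X (e j) = X 5 * y.
    apply/supp_from_deg/suppP => n nT; rewrite fps_coefD fps_coefN fps_coef_sum.
    have [/existsP[j /eqP ->]|nej] := boolP [exists j, n == e j].
      rewrite (bigD1 j) //= eqxx mulr1 big1 ?addr0 ?subrr // => i ij.
      by rewrite (inj_eq e_inj) eq_sym (negbTE ij) mulr0.
    rewrite big1 ?subr0 => [|j _]; last first.
      rewrite /= (_ : (n == e j) = false) ?mulr0 //.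
      by apply: contraNF nej => nj; apply/existsP; exists j.
    apply: contrapT => pn.
    have inT d : N2 d -> T (d + n)%N.
      by move=> Nd; apply: contrapT => /negP /(pT _ Nd).
    have := T_hom (inT 0%N isT) (inT 1%N isT) (inT 8 isT) (inT 9 isT).
    by rewrite (negbTE nT) (negbTE nej).
  have [x xE] := v_surj yT; have [g gE] := scaleV x.
  exists r, g => u; apply: v_inj.
  by rewrite raddfB vbE fE gE vZ xE rE -[ser _]/(X 5 * mser u) mulrAC -yE; ring.
- split=> [[g gE] j|mr]; last first.
    have [y yT yE] : exists2 y, y \in supp T & \sum_j ser (r j) * X (e j) = X 5 * y.
      apply: supp_from_deg; elim/big_rec: _ => [|j f _ fT]; first exact: supp0.
      apply: suppD fT; rewrite mulrC.
      apply: (@suppXnM _ (fun n => sgH n && (n != 0%N))) => [n /andP[]|]; first exact: e_max.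
      apply/suppP => n; rewrite negb_and negbK => /orP[nH|/eqP ->].
        exact: ser_coef0.
      exact: mr.
    have [x xE] := v_surj yT; have [g gE] := scaleV x.
    exists g => u; apply: v_inj; rewrite vbE gE vZ xE -[ser _]/(X 5 * mser u) yE; ring.
  (* At u = 1 the coefficient of t^(e j) sees only the constant term of r j: e j lies neither in 5 +
     T nor in e i + H for i other than j. *)
  have one : (1 : fps k) \in supp N2 by exact: (@suppXn k N2 0).
  have := congr1 v (gE (Mono one)); rewrite vbE mulr1 => sumE.
  set s : R^o := cover_inj residue_cover (Mono one) in sumE.
  have gs : v (g s) = X 5 * v (g 1).
    by rewrite -[s]mulr1 linearZ vZ -[ser s]/(X 5 * 1) mulr1.
  have : fps_coef (v (g s)) (e j) = 0.
    have /suppP gT := v_supp (g 1); rewrite gs; move: (e_notin j); apply/suppP.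
    by apply/suppXnM/v_supp => n; rewrite /from_deg leq_addr addKn.
  rewrite -sumE fps_coef_sum (bigD1 j) // big1 => [|i ij].
    by rewrite [LHS]addr0 mulrC fps_coefXnM ltnn subnn.
  rewrite mulrC; move: (e_indep ij); apply/suppP.
  by apply/suppXnM/serP => n; rewrite /from_deg leq_addr addKn.
Qed.

End BassNumbers.

Lemma bass_number1_ring : bass_number maxI 1 (R^o : lmodType R) 3.
Proof.
(* The degrees 12, 13, 14 are 5 plus the pseudo-Frobenius numbers 7, 8, 9. *)
apply: (@bass_number1_degrees R^o (@ser k) sgH _ _ _ _ _ (fun j : 'I_3 => (12 + j)%N)).
- by [].
- exact: ser_inj.
- exact: serP.
- by move=> f fH; exists (SRing fH).
- by move=> i j /addnI /val_inj.
- move=> n n0 n1 n8 n9.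
  have [->|n12] := eqVneq n 12%N; first by apply/orP; right; apply/existsP; exists ord0.
  have [->|n13] := eqVneq n 13%N.
    by apply/orP; right; apply/existsP; exists (inord 1); rewrite inordK.
  have [->|n14] := eqVneq n 14%N.
    by apply/orP; right; apply/existsP; exists (inord 2); rewrite inordK.
  by apply/orP; left; move: n0 n1 n8 n9; rewrite /from_deg /sgH; lia.
- by move=> j n; rewrite /N2 /sgH /=; lia.
- by move=> j; have := ltn_ord j; rewrite /from_deg /sgH; lia.
- by move=> j n; have := ltn_ord j; rewrite /from_deg /sgH; lia.
- move=> i j; rewrite -val_eqE /=; have := ltn_ord i; have := ltn_ord j.
  by rewrite /from_deg /sgH; lia.
Qed.

Lemma bass_number0_W : bass_number maxI 0 (mono k W) 0.
Proof.
apply: (@bass_number0_zero _ (@mser k W)); [by []|exact: mser_inj].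
Qed.

Lemma bass_number1_W : bass_number maxI 1 (mono k W) 1.
Proof.
(* Here 14 = 5 + 9, and 9 is the only degree outside W which every positive element of H moves into
   W. *)
apply: (@bass_number1_degrees _ (@mser k W) W _ _ _ _ _ (fun _ : 'I_1 => 14)).
- by [].
- exact: mser_inj.
- exact: mserP.
- by move=> f fW; exists (Mono fW).
- by move=> i j; rewrite !ord1.
- move=> n n0 n1 n8 n9.
  have [->|n14] := eqVneq n 14; first by apply/orP; right; apply/existsP; exists ord0.
  by apply/orP; left; move: n0 n1 n8 n9; rewrite /from_deg /W /=; lia.
- by move=> j n; rewrite /N2 /W /=; lia.
- by [].
- by move=> j n; rewrite /from_deg /sgH /W /=; lia.
- by move=> i j; rewrite !ord1.
Qed.

Lemma W_finitely_generated : finitely_generated (mono k W).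
Proof.
have XW i : (i < 3)%N -> X i \in supp W by move=> i3; apply: suppXn; rewrite /W /=; lia.
exists 3, (fun i : 'I_3 => Mono (XW i (ltn_ord i))) => w.
have [[[r0 r1] r2] _ <-] : range (cover_map (coverW k)) w by rewrite cover_surj.
exists (tnth [tuple r0; r1; r2]).
apply: mser_inj; rewrite !big_ord_recl big_ord0 !(tnth_nth 0) /=.
by rewrite addr0 mulr1 mulrC [ser r1 * _]mulrC [ser r2 * _]mulrC addrA.
Qed.

(** A map omega -> R is multiplication by q with q, t q, t^2 q in [R]. A term of q in degree 0, 6 or
    5 would give one in degree 1 or 7 of t q, or in degree 7 of t^2 q, and 1 and 7 are gaps. *)
Lemma trace_W : trace_ideal (mono k W) `<=` [set r | ser r \in supp (leq 10)].
Proof.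
apply: ideal_span_sub => [|_ [f [u ->]]].
  split=> [|x y|r x]; [exact: supp0|exact: suppD|].
  by apply: suppM (serP r) => i j; rewrite /sgH; lia.
have fZ (s : R) w : ser (f (s *: w)) = ser s * ser (f w) by rewrite linearZ.
have one : (1 : fps k) \in supp W by exact: (@suppXn k W 0).
have x1 : X 1 \in supp W by exact: suppXn.
have x2 : X 2 \in supp W by exact: suppXn.
set q := ser (f (Mono one)).
have fE w : ser (f w) = mser w * q by rewrite -(mono_hom_sym fZ) mul1r.
have q0 d n (xd : X d \in supp W) : ~~ sgH (d + n) -> fps_coef q n = 0.
  move=> dn; have := ser_coef0 (f (Mono xd)) dn.
  by rewrite fE fps_coefXnM ltnNge leq_addr addKn.
rewrite /= fE; apply: suppM (mserP u) (_ : q \in supp (leq 10)) => [i j|]; first by lia.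
apply/suppP => n n10; have [nH|nH] := boolP (sgH n); last exact: ser_coef0.
have [e|e] := eqVneq n 5; first by rewrite e; exact: (q0 2).
by apply: (q0 1) => //; move: nH n10 e; rewrite /sgH; lia.
Qed.

Lemma W_not_nearly_gorenstein : ~ nearly_gorenstein maxI (mono k W).
Proof.
have x5 : X 5 \in supp sgH by exact: suppXn.
have m5 : maxI (SRing x5) by [].
move=> /(_ _ m5) /trace_W /suppP /(_ 5 isT) /eqP.
by rewrite /= oner_eq0.
Qed.

End Local.

(** * The injective resolution of omega *)

Local Notation "x %:F" := (FracField.tofrac x).

Lemma fraction_numden (R : idomainType) (q : {fraction R}) :
  exists a b, b != 0 /\ q * b%:F = a%:F.
Proof.
elim/quotW: q => x; exists \n_x, \d_x; split; first exact: denom_ratioP.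
rewrite -[_ * _]/(FracField.mul _ _) !piE; apply/eqmodP.
rewrite /= FracField.equivfE /FracField.mulf !numden_Ratio ?mulr1 ?oner_eq0 ?denom_ratioP //.
by rewrite mulrC.
Qed.

Section Injective.
Variable k : fieldType.
Notation R := (sring k).
Notation X := (fps_Xn k).

Definition laurent : Type := {fraction fps k}.
HB.instance Definition _ := GRing.Field.on laurent.

Definition laurent_scale (r : R) (q : laurent) : laurent := (ser r)%:F * q.

Fact laurent_scaleA a b q : laurent_scale a (laurent_scale b q) = laurent_scale (a * b) q.
Proof. by rewrite /laurent_scale serM tofracM mulrA. Qed.
Fact laurent_scale1 : left_id 1 laurent_scale.
Proof. by move=> q; rewrite /laurent_scale ser1 tofrac1 mul1r. Qed.
Fact laurent_scaleDr : right_distributive laurent_scale +%R.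
Proof. by move=> a x y; exact: mulrDr. Qed.
Fact laurent_scaleDl q : {morph laurent_scale^~ q : a b / a + b}.
Proof. by move=> a b; rewrite /laurent_scale serD tofracD mulrDl. Qed.

HB.instance Definition _ := GRing.Zmodule_isLmodule.Build R laurent
  laurent_scaleA laurent_scale1 laurent_scaleDr laurent_scaleDl.

Lemma laurentZ (r : R) (q : laurent) : r *: q = (ser r)%:F * q :> laurent.
Proof. by []. Qed.

Lemma laurent_shift (q : laurent) : exists d f, q * (X d)%:F = f%:F.
Proof.
have [a [b [/fps_order [d [u [-> uu]]] qE]]] := fraction_numden q.
exists d, (a * u^-1); rewrite tofracM -qE !tofracM -!mulrA -tofracM divrr //.
by rewrite tofrac1 mulr1.
Qed.

(** The fraction f(x) / x is the same for all nonzero x in [I], since y f(x) = f(x y) = x f(y). *)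
Lemma laurent_injective : injective_module (laurent : lmodType R).
Proof.
apply: baer_criterion => I f [I0 ID IM] fD fZ.
have [[x [Ix x0]]|I_0] := pselect (exists x, I x /\ x <> 0); last first.
  exists 0 => x Ix; have -> : x = 0 by apply: contrapT => x0; apply: I_0; exists x.
  by have := fZ 0 0 I0; rewrite mul0r !scale0r.
have sx0 : (ser x)%:F != 0 :> laurent.
  rewrite tofrac_eq0; apply/eqP => sx0; apply: x0; exact: ser_inj.
exists ((ser x)%:F^-1 * f x) => y Iy.
have xy : y *: f x = x *: f y by rewrite -!fZ // mulrC.
by rewrite laurentZ mulrCA -laurentZ xy laurentZ mulKf.
Qed.

Definition order_ge N (x : R) := forall n, (n < N)%N -> fps_coef (ser x) n = 0.

(* Functionals that are continuous for the t-adic topology; they form the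
   injective hull of the residue field. *)
Definition continuous_functional (f : R -> k) : Prop :=
  (forall c x y, f (c *: x + y) = c * f x + f y) /\
  exists N, forall x, order_ge N x -> f x = 0.

Record dual := Dual { ev : R -> k; evP : continuous_functional ev }.

HB.instance Definition _ := gen_eqMixin dual.
HB.instance Definition _ := gen_choiceMixin dual.

Lemma dualP (f g : dual) : ev f =1 ev g -> f = g.
Proof.
case: f g => [f fP] [g gP] /= /funext fg; move: gP; rewrite -fg => gP.
by congr Dual; exact: Prop_irrelevance.
Qed.

Lemma ev_lin (f : dual) c x y : ev f (c *: x + y) = c * ev f x + ev f y.
Proof. by case: f => f [fL fC]; exact: fL. Qed.

Lemma evD (f : dual) x y : ev f (x + y) = ev f x + ev f y.
Proof. by rewrite -[x]scale1r ev_lin mul1r scale1r. Qed.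

Lemma ev0 (f : dual) : ev f 0 = 0.
Proof. by have := evD f 0 0; rewrite addr0 => /eqP; rewrite -subr_eq subrr => /eqP. Qed.

Lemma evZ (f : dual) c x : ev f (c *: x) = c * ev f x.
Proof. by rewrite -[c *: x]addr0 ev_lin ev0 addr0. Qed.

Lemma ev_sum (f : dual) (I : Type) (s : seq I) (P : pred I) (F : I -> R) :
  ev f (\sum_(i <- s | P i) F i) = \sum_(i <- s | P i) ev f (F i).
Proof. by elim/big_rec2: _ => [|i x y _ <-]; rewrite ?ev0 ?evD. Qed.

Lemma ev_continuous (f : dual) : exists N, forall x, order_ge N x -> ev f x = 0.
Proof. by case: f => f [fL fC]. Qed.

Lemma order_ge_le M N x : (M <= N)%N -> order_ge N x -> order_ge M x.
Proof. by move=> MN xN n nM; apply: xN; apply: leq_trans MN. Qed.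

Lemma order_geM N (r x : R) : order_ge N x -> order_ge N (r * x).
Proof.
move=> xN n nN; rewrite serM fps_coefM big1 // => i _.
by rewrite xN ?mulr0 // (leq_ltn_trans (leq_subr i n)).
Qed.

Fact dual_zero_subproof : continuous_functional (fun=> 0).
Proof. by split=> [c x y|]; [rewrite mulr0 addr0|exists 0%N]. Qed.
Definition dual_zero := Dual dual_zero_subproof.

Fact dual_opp_subproof (f : dual) : continuous_functional (fun x => - ev f x).
Proof.
split=> [c x y|]; first by rewrite ev_lin opprD mulrN.
by have [N fN] := ev_continuous f; exists N => x /fN ->; rewrite oppr0.
Qed.
Definition dual_opp f := Dual (dual_opp_subproof f).

Fact dual_add_subproof (f g : dual) : continuous_functional (fun x => ev f x + ev g x).
Proof.
split=> [c x y|]; first by rewrite !ev_lin mulrDr addrACA.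
have [M fM] := ev_continuous f; have [N gN] := ev_continuous g.
exists (maxn M N) => x xMN; rewrite fM ?gN ?addr0 //; apply: order_ge_le xMN.
  exact: leq_maxr.
exact: leq_maxl.
Qed.
Definition dual_add f g := Dual (dual_add_subproof f g).

Fact dual_scale_subproof (r : R) (f : dual) : continuous_functional (fun x => ev f (r * x)).
Proof.
split=> [c x y|]; first by rewrite mulrDr -scalerAr ev_lin.
by have [N fN] := ev_continuous f; exists N => x /(order_geM r) /fN.
Qed.
Definition dual_scale r f := Dual (dual_scale_subproof r f).

Fact dual_addA : associative dual_add.
Proof. by move=> f g h; apply: dualP => x /=; rewrite addrA. Qed.
Fact dual_addC : commutative dual_add.
Proof. by move=> f g; apply: dualP => x /=; rewrite addrC. Qed.
Fact dual_add0 : left_id dual_zero dual_add.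
Proof. by move=> f; apply: dualP => x /=; rewrite add0r. Qed.
Fact dual_addN : left_inverse dual_zero dual_opp dual_add.
Proof. by move=> f; apply: dualP => x /=; rewrite addNr. Qed.

HB.instance Definition _ :=
  GRing.isZmodule.Build dual dual_addA dual_addC dual_add0 dual_addN.

Fact dual_scaleA a b f : dual_scale a (dual_scale b f) = dual_scale (a * b) f.
Proof. by apply: dualP => x /=; rewrite mulrCA mulrA. Qed.
Fact dual_scale1 : left_id 1 dual_scale.
Proof. by move=> f; apply: dualP => x /=; rewrite mul1r. Qed.
Fact dual_scaleDr : right_distributive dual_scale +%R.
Proof. by move=> a f g; apply: dualP. Qed.
Fact dual_scaleDl f : {morph dual_scale^~ f : a b / a + b}.
Proof. by move=> a b; apply: dualP => x /=; rewrite mulrDl evD. Qed.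

HB.instance Definition _ := GRing.Zmodule_isLmodule.Build R dual
  dual_scaleA dual_scale1 dual_scaleDr dual_scaleDl.

Lemma ev_scale (r : R) (f : dual) x : ev (r *: f) x = ev f (r * x).
Proof. by []. Qed.
Lemma ev_add (f g : dual) x : ev (f + g) x = ev f x + ev g x.
Proof. by []. Qed.

Fact coef_functional_subproof (c : k) d :
  continuous_functional (fun x => c * fps_coef (ser x) d).
Proof.
split=> [a x y|]; first by rewrite /= mulrDr mulrCA.
by exists d.+1 => x xd; rewrite xd ?mulr0.
Qed.
Definition coef_functional c d := Dual (coef_functional_subproof c d).

(** Since f(x)(r) = phi(r x) for phi(x) = f(x)(1), it suffices to extend phi from [I] to a
    continuous functional on [R]. It vanishes on elements of [I] of high order, and from there the
    order is lowered one degree at a time. *)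
Lemma dual_injective : injective_module (dual : lmodType R).
Proof.
apply: baer_criterion => I f [I0 ID IM] fD fZ.
pose phi x := ev (f x) 1.
have phiM r x : I x -> phi (r * x) = ev (f x) r.
  by move=> Ix; rewrite /phi fZ // ev_scale mulr1.
have [N phiN] : exists N, forall x, I x -> order_ge N x -> phi x = 0.
  have [[x [Ix x0]]|I_0] := pselect (exists x, I x /\ x <> 0); last first.
    exists 0%N => x Ix _; have -> : x = 0 by apply: contrapT => x0; apply: I_0; exists x.
    by rewrite -(mul0r x) phiM ?ev0.
  have [|d [u [xE uu]]] := @fps_order _ (ser x).
    by apply/eqP => sx0; apply: x0; exact: ser_inj.
  have x10 (g : fps k) : X 10 * g \in supp sgH.
    by apply: (@suppXnM _ predT) => [n _|]; [rewrite /sgH leq_addr !orbT|exact/suppP].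
  (* A nonzero ideal contains a pure power of t, because t^10 / u lies in [R]. *)
  pose z : R := SRing (x10 u^-1) * x.
  have zE : ser z = X (10 + d).
    by rewrite serM /= xE mulrACA mulVr // mulr1 fps_XnD.
  have [N zN] := ev_continuous (f z).
  (* The second 10 ensures that y / t^(10 + d) lies in [R], and N that f(z) kills it. *)
  exists (10 + d + 10 + N)%N => y Iy yN.
  have y_low n : (n < 10 + d)%N -> fps_coef (ser y) n = 0.
    by move=> nd; apply: yN; apply: leq_trans nd _; rewrite -addnA leq_addr.
  have yE := fps_dropK y_low.
  have wH : fps_drop (10 + d) (ser y) \in supp sgH.
    apply/suppP => n nH; rewrite /= yN //; move: nH; rewrite /sgH; lia.
  have -> : y = SRing wH * z by apply: ser_inj; rewrite serM zE mulrC.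
  rewrite phiM; last exact: IM.
  by apply: zN => n nN; rewrite /= yN //; lia.
have approx n : exists e : dual, forall x, I x -> order_ge (N - n) x -> phi x = ev e x.
  elim: n => [|n [e eP]].
    by exists 0 => x Ix xN; rewrite phiN //; move: xN; rewrite subn0.
  have [nN|nN] := leqP N n.
    by exists e => x Ix xN; apply: eP => //; apply: order_ge_le xN; lia.
  set d := (N - n.+1)%N; have dE : (N - n = d.+1)%N by rewrite /d; lia.
  rewrite dE in eP.
  have [[z [Iz zd z0]]|nz] :=
    pselect (exists z, [/\ I z, order_ge d z & fps_coef (ser z) d != 0]); last first.
    exists e => x Ix xd; apply: eP => // m; rewrite ltnS leq_eqVlt => /predU1P[->|/xd //].
    by apply: contrapT => /eqP xd0; apply: nz; exists x.
  (* An element of [I] of order at least d is a k-multiple of z plus an element of order at least d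
     + 1, so only the value at z needs correction. *)
  exists (e + coef_functional ((phi z - ev e z) / fps_coef (ser z) d) d) => x Ix xd.
  pose a := fps_coef (ser x) d / fps_coef (ser z) d.
  have Iy : I (x + (- a *: 1) * z) by apply: ID => //; apply: IM.
  have yP : phi x + - a * phi z = ev e x + - a * ev e z.
    have az : phi ((- a *: 1) * z) = - a * phi z by rewrite phiM // evZ.
    have ae : ev e ((- a *: 1) * z) = - a * ev e z by rewrite -scalerAl mul1r evZ.
    have phiD : phi (x + (- a *: 1) * z) = phi x + phi ((- a *: 1) * z).
      by rewrite /phi fD //; apply: IM.
    rewrite -az -ae -phiD -evD; apply: eP => // m; rewrite -scalerAl mul1r.
    rewrite ltnS leq_eqVlt => /predU1P[->|md].
      by rewrite /= mulNr divfK // subrr.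
    by rewrite /= xd // zd // mulr0 addr0.
  have -> : phi x = ev e x + - a * ev e z + a * phi z by rewrite -yP; ring.
  rewrite ev_add [ev (coef_functional _ _) x]/= -mulrA [_^-1 * _]mulrC -/a; ring.
have [e eP] := approx N; exists e => x Ix; apply: dualP => y.
rewrite ev_scale mulrC -phiM // eP //; first exact: IM.
by move=> n; rewrite subnn.
Qed.


(* 9 is the Frobenius number of H. *)
Definition coef9_spec (q : laurent) (c : k) :=
  forall d f, q * (X d)%:F = f%:F -> c = fps_coef f (9 + d).

(** Two presentations f / t^d and g / t^e of q satisfy t^e f = t^d g, so the coefficient is
    independent of the choice. *)
Lemma coef9_exists (q : laurent) : exists c, coef9_spec q c.
Proof.
have [d [f qf]] := laurent_shift q; exists (fps_coef f (9 + d)) => e g qg.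
have fg : X e * f = X d * g.
  by apply/eqP; rewrite -tofrac_eq !tofracM -qf -qg; apply/eqP; ring.
have := congr1 (fun h => fps_coef h (9 + d + e)) fg.
rewrite !fps_coefXnM addnK [(9 + d + e)%N]addnAC addnK.
by rewrite !ltnNge leq_addl addnAC leq_addl.
Qed.

Definition coef9 (q : laurent) : k := sval (cid (coef9_exists q)).

Lemma coef9E (q : laurent) d f : q * (X d)%:F = f%:F -> coef9 q = fps_coef f (9 + d).
Proof. exact: (svalP (cid (coef9_exists q))). Qed.

Lemma laurent_shiftZ (q : laurent) d f (r : R) :
  q * (X d)%:F = f%:F -> (r *: q) * (X d)%:F = (ser r * f)%:F.
Proof. by move=> qf; rewrite laurentZ -mulrA qf tofracM. Qed.

Lemma coef9Z (q : laurent) d f (r : R) : q * (X d)%:F = f%:F ->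
  coef9 (r *: q) = fps_coef (ser r * f) (9 + d).
Proof. by move=> /(laurent_shiftZ r) /coef9E. Qed.

Fact residue_functional_subproof (q : laurent) :
  continuous_functional (fun x => coef9 (x *: q)).
Proof.
have [d [f qf]] := laurent_shift q; split=> [c x y|].
  rewrite !(coef9Z _ qf) -[ser _]/(c *: ser x + ser y) mulrDl -scalerAl.
  by rewrite fps_coefD fps_coefZ.
exists (10 + d)%N => x xd; rewrite (coef9Z _ qf) fps_coefM big1 // => i _.
by rewrite xd ?mul0r.
Qed.

Definition residue_functional (q : laurent) := Dual (residue_functional_subproof q).

Lemma residue_functional_linear :
  linear (residue_functional : laurent -> dual).
Proof.
move=> r p q; apply: dualP => x; rewrite ev_add ev_scale /=.
have [d [f pf]] := laurent_shift p; have [e [g qg]] := laurent_shift q.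
have pqf : (r *: p + q) * (X (d + e))%:F = (ser r * f * X e + g * X d)%:F.
  rewrite fps_XnD tofracM tofracD tofracM tofracM tofracM -pf -qg laurentZ; ring.
have pf' : p * (X (d + e))%:F = (f * X e)%:F by rewrite fps_XnD !tofracM -pf; ring.
have qg' : q * (X (d + e))%:F = (g * X d)%:F by rewrite fps_XnD !tofracM -qg; ring.
rewrite (coef9Z _ pqf) (coef9Z _ pf') (coef9Z _ qg') -fps_coefD serM.
by congr fps_coef; ring.
Qed.

Definition laurent_of_W (w : mono k W) : laurent := (mser w)%:F.

Lemma laurent_of_W_linear : linear laurent_of_W.
Proof.
move=> r x y; rewrite /laurent_of_W mserD mserZ tofracD tofracM //.
Qed.

(** Omega is the orthogonal of [R] for the pairing by the coefficient of t^9: testing q on t^n with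
    n in H kills its coefficient in degree 9 - n. The n above 9 exclude negative degrees, and the
    degrees left are W. *)
Lemma residue_functional_ker :
  range laurent_of_W = [set q | residue_functional q = 0].
Proof.
apply/seteqP; split=> [_ [w _ <-]|q /(congr1 ev) q0].
  apply: dualP => x /=; have e : laurent_of_W w * (X 0)%:F = (mser w)%:F.
    by rewrite fps_Xn0 tofrac1 mulr1.
  by rewrite (coef9Z _ e) -[ser x * _]/(mser (x *: w)) mser_coef0.
have [d [f qf]] := laurent_shift q.
have f0 n : sgH n -> (n <= 9 + d)%N -> fps_coef f (9 + d - n) = 0.
  move=> nH nd; have xn : X n \in supp sgH by exact: suppXn.
  have := congr1 (fun h => h (SRing xn)) q0; rewrite /= (coef9Z _ qf).
  by rewrite fps_coefXnM ltnNge nd.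
have fd : X d * fps_drop d f = f.
  apply: fps_dropK => n nd; rewrite -(@subKn n (9 + d)); last by lia.
  by apply: f0; rewrite /sgH; lia.
have wW : fps_drop d f \in supp W.
  apply/suppP => n nW; rewrite /= -(@subKn (d + n) (9 + d)).
    by apply: f0; move: nW; rewrite /W /sgH /=; lia.
  by move: nW; rewrite /W /=; lia.
exists (Mono wW) => //; apply: (@mulIf _ (X d)%:F); first by rewrite tofrac_eq0 fps_Xn_neq0.
by rewrite qf -[in RHS]fd tofracM mulrC.
Qed.

Lemma residue_functional_surj : range residue_functional = setT.
Proof.
rewrite -subTset => e _; have [N eN] := ev_continuous e.
(* The preimage of e is the sum of e(t^n) t^(9 - n) over n in H, a Laurent series because e(t^n) = 0
   for large n; f is its multiple by t^N. For a gap n, [to_sring] returns its default 0. *)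
pose t i : R := to_sring (X i).
pose f := Fps (fun n => if (n <= 9 + N)%N then ev e (t (9 + N - n)%N) else 0).
pose q : laurent := f%:F / (X N)%:F.
have qf : q * (X N)%:F = f%:F by rewrite divfK // tofrac_eq0 fps_Xn_neq0.
exists q => //; apply: dualP => x; rewrite /= (coef9Z _ qf) fps_coefM.
pose s : R := \sum_(i < (9 + N).+1) fps_coef (ser x) i *: t i.
have sN : order_ge N (x - s).
  move=> n nN; rewrite /= raddf_sum fps_coef_sum.
  have n9 : (n < (9 + N).+1)%N by lia.
  rewrite (bigD1 (Ordinal n9)) //= big1 ?addr0 => [|i].
    have [nH|nH] := boolP (sgH n).
      by rewrite to_sringK ?fps_coefXn ?eqxx ?mulr1 ?subrr //; apply: suppXn.
    by rewrite (ser_coef0 x nH) mul0r subrr.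
  rewrite -val_eqE /= => ni; have [iH|iH] := boolP (sgH i).
    by rewrite to_sringK ?fps_coefXn 1?eq_sym ?(negbTE ni) ?mulr0 //; apply: suppXn.
  by rewrite (ser_coef0 x iH) mul0r.
rewrite -[x in RHS](subrK s) evD (eN _ sN) add0r ev_sum; apply: eq_bigr => i _.
by rewrite evZ /= leq_subr subKn // -ltnS.
Qed.

Lemma W_finite_injective_dimension : finite_injective_dimension (mono k W).
Proof.
pose Z : lmodType R := 'rV[R]_0.
have Z0 (x : Z) : x = 0 by apply/rowP => -[].
pose E i : lmodType R := match i with 0 => laurent | 1 => dual | _ => Z end.
pose d i : {linear E i -> E i.+1} :=
  match i with 0 => linmap residue_functional_linear | _ => \0 end.
exists E, d, (linmap laurent_of_W_linear); split.
- case=> [|[|i]]; [exact: laurent_injective|exact: dual_injective|].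
  move=> A B j f _; exists (\0 : {linear B -> Z}) => x.
  by rewrite [RHS]Z0.
- by move=> x y /eqP; rewrite /= tofrac_eq => /eqP /mser_inj.
- exact: residue_functional_ker.
- case=> [|i]; first by rewrite [LHS]residue_functional_surj; apply/esym; rewrite -subTset.
  apply/seteqP; split=> [x _|x _]; first by [].
  by exists 0 => //; rewrite /= [RHS]Z0.
- by exists 2; case=> [|[|i]] // _ x; exact: Z0.
Qed.

End Injective.

(** * Embedding dimension, multiplicity and the semigroup *)

Section Invariants.
Variable k : fieldType.
Notation R := (sring k).
Notation X := (fps_Xn k).
Notation maxI := (@maxI k).

Definition sg_gens : seq nat := [:: 5; 6; 13; 14].

Lemma sg_gens_sgH n : n \in sg_gens -> sgH n.
Proof. by rewrite !inE => /or4P[] /eqP ->. Qed.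

Lemma ser_to_sring_Xn n : sgH n -> ser (to_sring (X n)) = X n.
Proof. by move=> nH; apply/to_sringK/suppXn. Qed.

Definition mgen (i : 'I_4) : R := to_sring (X (nth 0%N sg_gens i)).

Lemma ser_mgen i : ser (mgen i) = X (nth 0%N sg_gens i).
Proof. by apply/ser_to_sring_Xn/sg_gens_sgH/mem_nth. Qed.

Lemma maxI_mgen i : maxI (mgen i).
Proof. by rewrite /maxI /= ser_mgen; case: i => -[|[|[|[|]]]]. Qed.

(** The degrees 5, 6, 13, 14 are 5 plus the degrees 0, 1, 8, 9 of the generators of N2, supplied by
    the cover of N2. *)
Lemma maxI_generated : maxI = ideal_span (range mgen).
Proof.
apply/seteqP; split=> [r /maxI_shift [u uN2 rE]|]; last first.
  by apply: ideal_span_sub; [exact: maxI_ideal|move=> _ [i _ <-]; exact: maxI_mgen].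
have [s _ sE] : range (cover_map (coverN2 k)) (Mono uN2) by rewrite cover_surj.
exists 4, (tnth [tuple s.1.1.1; s.1.1.2; s.1.2; s.2]), mgen; split; first by move=> i; exists i.
apply: ser_inj; rewrite !big_ord_recl big_ord0 !(tnth_nth 0) !serD !serM !ser_mgen rE.
have <- : mser (cover_map (coverN2 k) s) = u by rewrite sE.
rewrite /= (fps_XnD k 5 1) (fps_XnD k 5 8) (fps_XnD k 5 9); ring.
Qed.

Lemma maxI_span_Xn : maxI = ideal_span [set x | exists2 n, n \in sg_gens & ser x = X n].
Proof.
apply/seteqP; split; last first.
  apply: ideal_span_sub; first exact: maxI_ideal.
  by move=> x [n + xE]; rewrite /maxI /= xE !inE => /or4P[] /eqP ->.
rewrite maxI_generated; apply: ideal_span_sub; first exact: ideal_span_ideal.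
move=> _ [i _ <-]; apply: ideal_span_gen; exists (nth 0%N sg_gens i); first exact: mem_nth.
exact: ser_mgen.
Qed.

Lemma maxI_min_generators : min_generators maxI 4.
Proof.
split; first by exists mgen; exact: maxI_generated.
move=> l [x xE].
(* On m this reads off the class modulo m^2: none of 5, 6, 13, 14 is a sum of two positive elements
   of H. Hence the images of generators of m span k^4. *)
pose v (y : R) : 'rV[k]_4 := \row_j fps_coef (ser y) (nth 0%N sg_gens j).
pose A : 'M[k]_(l, 4) := \matrix_i v (x i).
have vM r y : maxI y -> v (r * y) = fps_coef (ser r) 0 *: v y.
  move=> /maxI_shift [w /suppP wN2 yE]; apply/rowP => j; rewrite !mxE serM yE mulrCA !fps_coefXnM.
  case: ltnP => [_|j5]; first by rewrite mulr0.
  rewrite fps_coefM big_ord_recl subn0 big1 ?addr0 // => i _; rewrite lift0.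
  have [iH|iH] := boolP (sgH i.+1); last by rewrite ser_coef0 ?mul0r.
  rewrite wN2 ?mulr0 //; move: (nat_of_ord i) (ltn_ord i) iH {j5} => {}i.
  by case: j i => -[|[|[|[|]]]] //= _ i; rewrite /sgH /N2 /=; lia.
have sub : maxI `<=` [set y | maxI y /\ (v y <= A)%MS].
  rewrite {1}xE; apply: ideal_span_sub.
    have [m0 mD mM] := maxI_ideal k; split.
    - by split=> //; rewrite (_ : v 0 = 0) ?sub0mx //; apply/rowP => j; rewrite !mxE.
    - move=> y z [my vy] [mz vz]; split; first exact: mD.
      rewrite (_ : v (y + z) = v y + v z) ?addmx_sub //.
      by apply/rowP => j; rewrite !mxE.
    - by move=> r y [my vy]; split; [exact: mM|rewrite vM // scalemx_sub].
  move=> _ [i _ <-]; split.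
    by rewrite xE; apply: ideal_span_gen; exists i.
  by rewrite (_ : v (x i) = row i A) ?row_sub // rowK.
suff /mxrankS : ((1%:M : 'M[k]_4) <= A)%MS.
  by rewrite mxrank1 => /leq_trans; apply; exact: rank_leq_row.
apply/row_subP => j; have [_] := sub _ (maxI_mgen j).
congr (_ <= _)%MS; apply/rowP => i; rewrite !mxE ser_mgen fps_coefXn eq_sym.
congr (_%:R); rewrite -val_eqE /=.
by case: i j => -[|[|[|[|]]]] // ? -[[|[|[|[|]]]]].
Qed.

Definition ordI (S : pred nat) : set R := [set r | ser r \in supp S].

Lemma ordI_ideal (S : pred nat) : (forall h n, sgH h -> S n -> S (h + n)%N) -> is_ideal (ordI S).
Proof.
move=> SH; split=> [|x y|r x]; [exact: supp0|exact: suppD|].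
by apply: suppM (serP r) => h n; apply: SH.
Qed.

(* The degrees of m^l, for l > 0. *)
Definition powT (l : nat) : pred nat := fun n => (5 * l <= n <= 6 * l)%N || (5 * l + 5 <= n)%N.

Lemma powT_ideal l : (0 < l)%N -> is_ideal (ordI (powT l)).
Proof. by move=> l0; apply: ordI_ideal => h n; rewrite /sgH /powT; lia. Qed.

Lemma maxI_powT : maxI = ordI (powT 1).
Proof.
apply/seteqP; split=> [r r0|r /suppP rT]; last exact: rT.
apply/suppP => n nT; have [nH|nH] := boolP (sgH n); last exact: ser_coef0.
have [->|n0] := eqVneq n 0%N; first exact: r0.
by move: nH nT n0; rewrite /sgH /powT; lia.
Qed.

(** The ideal (t^5, t^6) is a reduction of m: shifts by 5 and 6 alone reach every degree of the next
    power. *)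
Lemma maxI_mul_powT l : (0 < l)%N -> ideal_mul maxI (ordI (powT l)) = ordI (powT l.+1).
Proof.
move=> l0; apply/seteqP; split.
  apply: ideal_span_sub; first exact: powT_ideal.
  move=> _ [x [y [mx yT ->]]]; move: mx; rewrite maxI_powT => mx.
  by apply: suppM mx yT => i j; rewrite /powT; lia.
move=> r rT.
have TH n : powT l n -> sgH n by rewrite /powT /sgH; lia.
pose P1 n := from_deg 5 (powT l) n.
pose P2 n := ~~ P1 n && from_deg 6 (powT l) n.
have [u1 u1T e1] : exists2 u, u \in supp (powT l) & fps_restrict P1 (ser r) = X 5 * u.
  exact/supp_from_deg/supp_restrict.
have [u2 u2T e2] : exists2 u, u \in supp (powT l) & fps_restrict P2 (ser r) = X 6 * u.
  by apply/supp_from_deg/supp_restrict => n /andP[].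
have rE : ser r = X 5 * u1 + X 6 * u2.
  rewrite -e1 -e2; apply: fpsP => n; rewrite fps_coefD /= /P2.
  have [nP1|nP1] /= := boolP (P1 n); first by rewrite addr0.
  rewrite add0r; case: ifP => // nP2; apply: (suppP _ _ rT).
  by move: nP1 nP2; rewrite /P1 /from_deg /powT; lia.
have -> : r = to_sring (X 5) * SRing (supp_sub TH u1T) + to_sring (X 6) * SRing (supp_sub TH u2T).
  by apply: ser_inj; rewrite serD !serM !ser_to_sring_Xn.
have [_ sD _] := ideal_span_ideal
  [set z | exists x y, [/\ maxI x, ordI (powT l) y & z = x * y]].
apply: sD; apply: ideal_span_gen.
  exists (to_sring (X 5)), (SRing (supp_sub TH u1T)); split=> //.
  by rewrite /maxI /= ser_to_sring_Xn.
exists (to_sring (X 6)), (SRing (supp_sub TH u2T)); split=> //.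
by rewrite /maxI /= ser_to_sring_Xn.
Qed.

Lemma maxI_exp l : ideal_exp maxI l.+1 = ordI (powT l.+1).
Proof.
elim: l => [|l IH]; last by rewrite -maxI_mul_powT // -IH.
rewrite -maxI_powT; apply/seteqP; split.
  apply: ideal_span_sub; first exact: maxI_ideal.
  move=> _ [x [y [mx _ ->]]]; have [_ _ mM] := maxI_ideal k.
  by rewrite mulrC; apply: mM.
by move=> r mr; apply: ideal_span_gen; exists r, 1; rewrite mulr1.
Qed.

(** The number 7 counts the gaps 1, 2, 3, 4, 7, 8, 9; the composition series runs through the orders
    [h i], which enumerate H. *)
Lemma colength_ordI n : (10 <= n)%N -> colength (ordI (leq n)) (n - 7).
Proof.
move=> n10.
pose h i := if (i <= 2)%N then nth 0%N [:: 0; 5; 6]%N i else (7 + i)%N.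
have hH i : sgH (h i) by rewrite /h; case: i => [|[|[|i]]].
have hlt i : (h i < h i.+1)%N by rewrite /h; case: i => [|[|[|i]]] //=; lia.
have hgap i m : (h i < m < h i.+1)%N -> ~~ sgH m.
  by rewrite /h; case: i => [|[|[|i]]] /=; rewrite /sgH; lia.
have ideal_h i : is_ideal (ordI (leq (h i))) by apply: ordI_ideal => m p; rewrite /sgH; lia.
exists (fun i => ordI (leq (h i))); split=> //.
- by rewrite -subTset => r _; apply/suppP.
- by rewrite (_ : h (n - 7)%N = n) // /h; case: leqP; lia.
move=> i _; split.
- by move=> r; apply: supp_sub => m; apply: leq_trans; apply: ltnW.
- move=> e; have : ordI (leq (h i)) (to_sring (X (h i))).
    by rewrite /ordI /= ser_to_sring_Xn //; apply: suppXn.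
  rewrite -e => /suppP /(_ (h i)); rewrite -ltnNge hlt => /(_ isT) /eqP.
  by rewrite ser_to_sring_Xn // fps_coefXn eqxx oner_eq0.
move=> L [L0 LD LM] JL LJ.
have low r m : ordI (leq (h i)) r -> fps_coef (ser r) (h i) = 0 -> (m < h i.+1)%N ->
    fps_coef (ser r) m = 0.
  move=> /suppP rJ r0 mh; have [mi|im|->] := ltngtP m (h i); last exact: r0.
    by apply: rJ; rewrite -ltnNge.
  by apply: ser_coef0; apply: (hgap i); rewrite im.
have [[z [Lz zh]]|nz] := pselect (exists z, L z /\ fps_coef (ser z) (h i) != 0); [right|left].
  apply/seteqP; split=> // r rJ.
  pose c := fps_coef (ser r) (h i) / fps_coef (ser z) (h i).
  have [_ JD JM] := ideal_h i.
  rewrite -[r](subrK ((c *: 1) * z)); apply: LD; last exact: LM.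
  apply: JL; apply/suppP => m; rewrite -ltnNge => mh; apply: low mh.
    by rewrite -mulNr; apply: JD => //; apply: JM; apply: LJ.
  by rewrite -scalerAl mul1r /= divfK // subrr.
apply/seteqP; split=> // r Lr; apply/suppP => m; rewrite -ltnNge => mh.
apply: low mh; first exact: LJ.
by apply: contrapT => /eqP rh; apply: nz; exists r.
Qed.

Lemma maxI_multiplicity : hilbert_samuel_multiplicity maxI 5.
Proof.
(* For large l the power m^(l+1) is the ideal of all series of order at least 5 (l + 1), of colength
   5 (l + 1) - 7 = 5 l - 2. *)
exists (5%:P * 'X + (-2)%:P); split; last first.
  have s2 : size (5%:P * 'X + (-2)%:P : {poly rat}) = 2.
    by rewrite size_MXaddC polyC_eq0 /= size_polyC.
  by rewrite lead_coefE s2 /= coefD coefMX !coefC /= addr0 mulr1.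
exists 4 => l l4; exists (5 * l.+1 - 7)%N; last first.
  rewrite !hornerE natrB; last by lia.
  by rewrite natrM -addn1 natrD; ring.
rewrite maxI_exp (_ : powT l.+1 = leq (5 * l.+1)); first by apply: colength_ordI; lia.
by apply/funext => n; rewrite /powT; lia.
Qed.

(** The least elements of H in the classes modulo 5 are 0, 6, 12, 13, 14. Only 12 = 6 + 6 is neither
    0 nor a generator, hence its separate witness. *)
Lemma in_semigroup_sg_gens n : in_semigroup sg_gens n <-> sgH n.
Proof.
split=> [[c ->]|nH].
  by rewrite !big_ord_recl big_ord0 /= /sgH; lia.
pose c r i := (if i == 0 then (n - r) %/ 5 else nth 0 sg_gens i == r)%N : nat.
have c_ok r : (r \in 0 :: behead sg_gens)%N ->
    (n = 5 * ((n - r) %/ 5) + r)%N -> in_semigroup sg_gens n.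
  move=> rg nE; exists (c r); rewrite !big_ord_recl big_ord0 /= /c /=.
  by move: rg; rewrite !inE => /or4P[] /eqP rE; move: nE; rewrite rE /=; lia.
have : (n %% 5 < 5)%N by rewrite ltn_mod.
case E : (n %% 5)%N => [|[|[|[|[|]]]]] // _.
- by apply: (c_ok 0%N) => //; lia.
- by apply: (c_ok 6) => //; move: nH; rewrite /sgH; lia.
- exists (fun i => if i == 0 then (n - 12) %/ 5 else if i == 1 then 2 else 0)%N.
  by rewrite !big_ord_recl big_ord0 /=; move: nH; rewrite /sgH; lia.
- by apply: (c_ok 13) => //; move: nH; rewrite /sgH; lia.
- by apply: (c_ok 14) => //; move: nH; rewrite /sgH; lia.
Qed.

Lemma sring_semigroup_ring : numerical_semigroup_ring sg_gens maxI.
Proof.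
split; first by split=> //; rewrite !big_cons big_nil.
right; exists (@ser k); split; [exact: ser_inj| |exact: maxI_span_Xn].
apply/seteqP; split=> [_ [r _ <-] n rn|f fH].
  by apply/in_semigroup_sg_gens; apply: contraNT rn => /ser_coef0 ->.
have fS : f \in supp sgH.
  by apply/suppP => n nH; apply: contraNeq nH => /fH /in_semigroup_sg_gens.
by exists (SRing fS).
Qed.

End Invariants.

Theorem theorem1p3 :
  exists (k : fieldType) (a : seq nat) (R : comAlgType k) (m : set R)
         (omega : lmodType R),
    numerical_semigroup_ring a m /\
    min_generators m 4 /\
    hilbert_samuel_multiplicity m 5 /\
    bass_number m 1 (R^o : lmodType R) 3 /\
    canonical_module omega /\
    (forall i : nat, (0 < i)%N -> annihilates_Ext m i omega (R^o : lmodType R)) /\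
    ~ nearly_gorenstein m omega.
Proof.
exists rat, sg_gens, (sring rat), (@maxI rat), (mono rat W).
split; first exact: sring_semigroup_ring.
split; first exact: maxI_min_generators.
split; first exact: maxI_multiplicity.
split; first exact: bass_number1_ring.
split; last by split; [exact: annihilates_Ext_W|exact: W_not_nearly_gorenstein].
split; [exact: W_finitely_generated|exact: W_finite_injective_dimension|].
by move=> n /maximal_idealE ->; split; [exact: bass_number0_W|exact: bass_number1_W].
Qed.
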